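(* Let $n\ge 1$, let $(M,\phi,\xi,\eta,g)$ be a $(2n+1)$-dimensional $(\alpha,\beta)$-contact metric manifold, and let $\lambda$ be a smooth function on $M$ such that $(\xi,\lambda)$ defines an almost Riemann soliton (respectively, an almost Ricci soliton) on $M$. Let $Q$ be the Ricci operator. (i) If $\nabla Q=0$, then $\alpha=0$ and $M$ is of constant scalar curvature $2n(2n+1)\lambda$ (respectively, $(2n+1)\lambda$). (ii) If $\phi^2\circ\nabla Q=0$, i.e. $\phi^2((\nabla_XQ)Y)=0$ for all vector fields $X,Y$, then either $M$ is a cosymplectic manifold, or $\alpha=0$, $\beta\neq0$ everywhere, $\lambda$ is a constant and $M$ is of constant scalar curvature $2n(2n+1)\lambda$ (respectively, $(2n+1)\lambda$).
   Context: Manifolds are smooth and connected. An almost contact metric manifold $(M,\phi,\xi,\eta,g)$ of dimension $2n+1$ is a smooth manifold $M$ with a $(1,1)$-tensor field $\phi$, a vector field $\xi$, a $1$-form $\eta$ and a Riemannian metric $g$ such that $\phi^2=-(\mathrm{Id}-\eta\otimes\xi)$, $\eta(\xi)=1$, $\phi\xi=0$, $\eta\circ\phi=0$, $i_\xi g=\eta$, $g(\phi X,\phi Y)=g(X,Y)-\eta(X)\eta(Y)$ and $g(\phi X,Y)=-g(X,\phi Y)$ for all vector fields $X,Y$. It is an $(\alpha,\beta)$-contact metric manifold (trans-Sasakian manifold) if there are smooth functions $\alpha,\beta$ on $M$ such that the Levi-Civita connection $\nabla$ of $g$ satisfies $$(\nabla_X\phi)Y=\alpha[g(\phi X,Y)\xi-\eta(Y)\phi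 X]+\beta[g(X,Y)\xi-\eta(Y)X]$$ for all vector fields $X,Y$. It is cosymplectic if $\alpha=\beta=0$. Conventions: $R(X,Y,Z,W)=g(R(X,Y)Z,W)$ with $R(X,Y)Z=\nabla_X\nabla_YZ-\nabla_Y\nabla_XZ-\nabla_{[X,Y]}Z$; $\operatorname{Ric}(Y,Z)=\sum_i R(E_i,Y,Z,E_i)$ for an orthonormal frame $\{E_i\}$; the Ricci operator $Q$ is defined by $g(QX,Y)=\operatorname{Ric}(X,Y)$; the scalar curvature is the trace of $Q$. The Kulkarni–Nomizu product of two $(0,2)$-tensor fields is $$(T_1\odot T_2)(X,Y,Z,W)=T_1(X,W)T_2(Y,Z)+T_1(Y,Z)T_2(X,W)-T_1(X,Z)T_2(Y,W)-T_1(Y,W)T_2(X,Z).$$ For a vector field $V$ and a smooth function $\lambda$, with $\pounds_V$ the Lie derivative: $(V,\lambda)$ defines an almost Riemann soliton if $\frac12\pounds_Vg\odot g+R=\lambda G$, where $G=\frac12 g\odot g$; it defines an almost Ricci soliton if $\frac12\pounds_Vg+\operatorname{Ric}=\lambda g$. *)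

(* Defs.v *)
From HB Require Import structures.
From mathcomp Require Import all_boot all_order all_algebra.
From mathcomp Require Import all_classical all_reals all_analysis.
Set Implicit Arguments.
Unset Strict Implicit.
Unset Printing Implicit Defensive.
Import Order.TTheory GRing.Theory Num.Theory.
Import numFieldNormedType.Exports.
Local Open Scope classical_set_scope.
Local Open Scope ring_scope.

(** For an open set O: continuous on O, and all the iterated partial
    derivatives of order at most k exist and are continuous on O. *)
Fixpoint is_Ck (R : realType) (m : nat) (W : normedModType R) (k : nat)
    (O : set 'rV[R]_m) (f : 'rV[R]_m -> W) : Prop :=
  (forall x, O x -> {for x, continuous f}) /\
  match k with
  | 0 => True
  | k'.+1 => forall i : 'I_m,
      (forall x, O x -> derivable f x (delta_mx 0 i)) /\
      is_Ck k' O (fun x => 'D_(delta_mx 0 i) f x)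
  end.

Definition is_Cinfty (R : realType) (m : nat) (W : normedModType R)
    (O : set 'rV[R]_m) (f : 'rV[R]_m -> W) : Prop :=
  forall k, is_Ck k O f.

Record chart (R : realType) (m : nat) (T : topologicalType) := Chart {
  cdom : set T;
  cmap : T -> 'rV[R]_m;
  cinv : 'rV[R]_m -> T;
  cdom_open : open cdom;
  cimg_open : open (cmap @` cdom);
  cmapK : forall p, cdom p -> cinv (cmap p) = p;
  cmap_continuous : forall p, cdom p -> {for p, continuous cmap};
  cinv_continuous : forall x, (cmap @` cdom) x -> {for x, continuous cinv}
}.

(** A smooth connected manifold without boundary, with an atlas that need not
    be maximal. [chart_at p] is a preferred chart around p; it only serves to
    represent tangent vectors (see [tderive]). *)
Record manifold (R : realType) (m : nat) := Manifold {
  carrier :> topologicalType;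
  atlas : set (chart R m carrier);
  chart_at : carrier -> chart R m carrier;
  chart_at_atlas : forall p, atlas (chart_at p);
  chart_at_dom : forall p, cdom (chart_at p) p;
  atlas_smooth : forall c c', atlas c -> atlas c' ->
    is_Cinfty (cmap c @` (cdom c `&` cdom c')) (cmap c' \o cinv c);
  manifold_hausdorff : hausdorff_space carrier;
  manifold_second_countable : @second_countable carrier;
  manifold_connected : connected [set: carrier]
}.

Section Tensors.
Context (R : realType) (m : nat) (M : manifold R m).

(** A function on the open set U of M is a function on M whose values outside
    of U are irrelevant. *)
Definition smooth_on (W : normedModType R) (U : set M) (f : M -> W) : Prop :=
  forall c, atlas c -> is_Cinfty (cmap c @` (U `&` cdom c)) (f \o cinv c).

(** A tangent vector at p is represented by the row vector of its components
    in the chart [chart_at p]; [tderive F p v] is the derivative dF_p(v). *)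
Definition tderive (W : normedModType R) (F : M -> W) (p : M) (v : 'rV[R]_m)
    : W :=
  'D_v (F \o cinv (chart_at p)) (cmap (chart_at p) p).

Definition vfield := M -> 'rV[R]_m.

Definition along (W : normedModType R) (X : vfield) (F : M -> W) : M -> W :=
  fun p => tderive F p (X p).

(** The components of X in the chart c, as a function on the domain of c. *)
Definition components (c : chart R m M) (X : vfield) : M -> 'rV[R]_m :=
  along X (cmap c).

Definition smooth_vfield (U : set M) (X : vfield) : Prop :=
  forall c, atlas c -> smooth_on (U `&` cdom c) (components c X).

(** [X, Y], computed at p in the chart [chart_at p]. *)
Definition lie_bracket (X Y : vfield) : vfield := fun p =>
  tderive (components (chart_at p) Y) p (X p) -
  tderive (components (chart_at p) X) p (Y p).

(** Tensor fields are given pointwise, in the components of [chart_at p]. As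
    vectors are rows, an endomorphism A acts by [v *m A p]. *)
Definition endofield := M -> 'M[R]_m.
Definition oneform := M -> 'cV[R]_m.
Definition bilfield := M -> 'M[R]_m.

Definition ev1 (w : oneform) (p : M) (v : 'rV[R]_m) : R := (v *m w p) 0 0.
Definition ev2 (b : bilfield) (p : M) (u v : 'rV[R]_m) : R :=
  (u *m b p *m v^T) 0 0.

Definition endo_app (A : endofield) (X : vfield) : vfield :=
  fun p => X p *m A p.

(** A tensor field is smooth when it sends smooth vector fields to smooth
    vector fields or functions. *)
Definition smooth_endofield (A : endofield) : Prop :=
  forall (U : set M) X, open U -> smooth_vfield U X ->
    smooth_vfield U (endo_app A X).

Definition smooth_oneform (w : oneform) : Prop :=
  forall (U : set M) X, open U -> smooth_vfield U X ->
    smooth_on U (fun p => ev1 w p (X p) : R^o).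

Definition smooth_bilfield (b : bilfield) : Prop :=
  forall (U : set M) X Y, open U -> smooth_vfield U X -> smooth_vfield U Y ->
    smooth_on U (fun p => ev2 b p (X p) (Y p) : R^o).

Definition smooth_function (f : M -> R) : Prop :=
  smooth_on setT (f : M -> R^o).

Record riemannian_metric (g : bilfield) : Prop := RiemannianMetric {
  metric_smooth : smooth_bilfield g;
  metric_sym : forall p u v, ev2 g p u v = ev2 g p v u;
  metric_pos : forall p u, u != 0 -> 0 < ev2 g p u u
}.

Definition tensor02 := vfield -> vfield -> M -> R.
Definition tensor04 := vfield -> vfield -> vfield -> vfield -> M -> R.

Definition met (g : bilfield) : tensor02 := fun X Y p => ev2 g p (X p) (Y p).

(** The connection acts on vector fields over any open subset U. As f may be
    the indicator function of U, which is smooth on U, the axioms imply that on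
    U the field [nabla X Y] depends only on the restrictions of X and Y to U. *)
Record levi_civita (g : bilfield) (nabla : vfield -> vfield -> vfield)
    : Prop := LeviCivita {
  nabla_smooth : forall (U : set M) X Y, open U ->
    smooth_vfield U X -> smooth_vfield U Y -> smooth_vfield U (nabla X Y);
  nabla_linear : forall (U : set M) X X' Y (f : M -> R), open U ->
    smooth_vfield U X -> smooth_vfield U X' -> smooth_vfield U Y ->
    smooth_on U (f : M -> R^o) -> forall p, U p ->
    nabla (fun q => f q *: X q + X' q) Y p = f p *: nabla X Y p + nabla X' Y p;
  nabla_additive : forall (U : set M) X Y Y', open U ->
    smooth_vfield U X -> smooth_vfield U Y -> smooth_vfield U Y' ->
    forall p, U p ->
    nabla X (fun q => Y q + Y' q) p = nabla X Y p + nabla X Y' p;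
  nabla_leibniz : forall (U : set M) X Y (f : M -> R), open U ->
    smooth_vfield U X -> smooth_vfield U Y -> smooth_on U (f : M -> R^o) ->
    forall p, U p ->
    nabla X (fun q => f q *: Y q) p =
      f p *: nabla X Y p + along X (f : M -> R^o) p *: Y p;
  nabla_torsion_free : forall (U : set M) X Y, open U ->
    smooth_vfield U X -> smooth_vfield U Y -> forall p, U p ->
    nabla X Y p - nabla Y X p = lie_bracket X Y p;
  nabla_metric : forall (U : set M) X Y Z, open U ->
    smooth_vfield U X -> smooth_vfield U Y -> smooth_vfield U Z ->
    forall p, U p ->
    along X (met g Y Z : M -> R^o) p =
      met g (nabla X Y) Z p + met g Y (nabla X Z) p
}.

Section Connection.
Variables (g : bilfield) (nabla : vfield -> vfield -> vfield).

Definition nabla_endo (A : endofield) (X Y : vfield) : vfield := fun p =>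
  nabla X (endo_app A Y) p - endo_app A (nabla X Y) p.

Definition curvature (X Y Z : vfield) : vfield := fun p =>
  nabla X (nabla Y Z) p - nabla Y (nabla X Z) p - nabla (lie_bracket X Y) Z p.

Definition curvature4 : tensor04 := fun X Y Z W => met g (curvature X Y Z) W.

Definition orthonormal_frame (U : set M) (E : 'I_m -> vfield) : Prop :=
  (forall i, smooth_vfield U (E i)) /\
  (forall p, U p -> forall i j, met g (E i) (E j) p = (i == j)%:R).

Definition is_ricci_tensor (Ric : tensor02) : Prop :=
  forall (U : set M) E Y Z, open U -> orthonormal_frame U E ->
    smooth_vfield U Y -> smooth_vfield U Z -> forall p, U p ->
    Ric Y Z p = \sum_i curvature4 (E i) Y Z (E i) p.

Definition is_ricci_operator (Ric : tensor02) (Q : endofield) : Prop :=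
  smooth_endofield Q /\
  forall (U : set M) X Y, open U -> smooth_vfield U X -> smooth_vfield U Y ->
    forall p, U p -> met g (endo_app Q X) Y p = Ric X Y p.

Definition scalar_curvature (Q : endofield) : M -> R := fun p => \tr (Q p).

Definition lie_metric (V : vfield) : tensor02 := fun X Y p =>
  along V (met g X Y : M -> R^o) p - met g (lie_bracket V X) Y p
  - met g X (lie_bracket V Y) p.

Definition kulkarni_nomizu (S T : tensor02) : tensor04 := fun X Y Z W p =>
  S X W p * T Y Z p + S Y Z p * T X W p
  - S X Z p * T Y W p - S Y W p * T X Z p.

Definition almost_riemann_soliton (V : vfield) (lambda : M -> R) : Prop :=
  forall (U : set M) X Y Z W, open U -> smooth_vfield U X ->
    smooth_vfield U Y -> smooth_vfield U Z -> smooth_vfield U W ->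
    forall p, U p ->
    2^-1 * kulkarni_nomizu (lie_metric V) (met g) X Y Z W p
      + curvature4 X Y Z W p
    = lambda p * (2^-1 * kulkarni_nomizu (met g) (met g) X Y Z W p).

Definition almost_ricci_soliton (Ric : tensor02) (V : vfield)
    (lambda : M -> R) : Prop :=
  forall (U : set M) X Y, open U -> smooth_vfield U X -> smooth_vfield U Y ->
    forall p, U p ->
    2^-1 * lie_metric V X Y p + Ric X Y p = lambda p * met g X Y p.

End Connection.

Record almost_contact_metric (phi : endofield) (xi : vfield) (eta : oneform)
    (g : bilfield) : Prop := AlmostContactMetric {
  acm_phi_smooth : smooth_endofield phi;
  acm_xi_smooth : smooth_vfield setT xi;
  acm_eta_smooth : smooth_oneform eta;
  acm_metric : riemannian_metric g;
  acm_phi_sq : forall p v,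
    v *m phi p *m phi p = - (v - ev1 eta p v *: xi p);
  acm_eta_xi : forall p, ev1 eta p (xi p) = 1;
  acm_phi_xi : forall p, xi p *m phi p = 0;
  acm_eta_phi : forall p v, ev1 eta p (v *m phi p) = 0;
  acm_dual : forall p v, ev2 g p (xi p) v = ev1 eta p v;
  acm_compat : forall p u v, ev2 g p (u *m phi p) (v *m phi p) =
    ev2 g p u v - ev1 eta p u * ev1 eta p v;
  acm_skew : forall p u v,
    ev2 g p (u *m phi p) v = - ev2 g p u (v *m phi p)
}.

(** [nabla] is meant to be the Levi-Civita connection of g. *)
Record alpha_beta_contact (nabla : vfield -> vfield -> vfield)
    (phi : endofield) (xi : vfield) (eta : oneform) (g : bilfield)
    (alpha beta : M -> R) : Prop := AlphaBetaContact {
  abc_acm : almost_contact_metric phi xi eta g;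
  abc_alpha_smooth : smooth_function alpha;
  abc_beta_smooth : smooth_function beta;
  abc_nabla_phi : forall (U : set M) X Y, open U ->
    smooth_vfield U X -> smooth_vfield U Y -> forall p, U p ->
    nabla_endo nabla phi X Y p =
      alpha p *: (met g (endo_app phi X) Y p *: xi p
                  - ev1 eta p (Y p) *: endo_app phi X p)
      + beta p *: (met g X Y p *: xi p - ev1 eta p (Y p) *: X p)
}.

Definition cosymplectic (alpha beta : M -> R) : Prop :=
  forall p, alpha p = 0 /\ beta p = 0.

Definition is_constant (f : M -> R) : Prop := exists k, forall p, f p = k.

Definition parallel_endo (nabla : vfield -> vfield -> vfield) (Q : endofield)
    : Prop :=
  forall (U : set M) X Y, open U -> smooth_vfield U X -> smooth_vfield U Y ->
    forall p, U p -> nabla_endo nabla Q X Y p = 0.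

Definition phi_parallel_endo (nabla : vfield -> vfield -> vfield)
    (phi Q : endofield) : Prop :=
  forall (U : set M) X Y, open U -> smooth_vfield U X -> smooth_vfield U Y ->
    forall p, U p ->
    endo_app phi (endo_app phi (nabla_endo nabla Q X Y)) p = 0.

End Tensors.

Arguments vfield {R m} M.
Arguments endofield {R m} M.
Arguments oneform {R m} M.
Arguments bilfield {R m} M.
Arguments tensor02 {R m} M.
Arguments tensor04 {R m} M.

(* Main.v *)
From HB Require Import structures.
Require Import Defs.
From mathcomp Require Import all_boot all_order all_algebra.
From mathcomp Require Import all_classical all_reals all_analysis.
From mathcomp Require Import ring.
Set Implicit Arguments.
Unset Strict Implicit.
Unset Printing Implicit Defensive.
Import Order.TTheory GRing.Theory Num.Theory.
Import numFieldNormedType.Exports.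
Local Open Scope classical_set_scope.
Local Open Scope ring_scope.

(** The proof reads everything off the eigenvalues of the Ricci operator.

    Applying the defining equation of the structure to xi gives
    nabla_X xi = alpha (X - eta(X) xi) - beta phi X ([nabla_xi]), hence half
    the Lie derivative of g along xi is alpha (g - eta (x) eta)
    ([lie_metric_xi]).  Either soliton equation then determines Ric: it is
    already solved for Ric in one case, and in the other it is solved for R and
    contracted over an orthonormal frame.  Both times
    Q = a Id + c alpha (eta (x) xi) for a nonzero constant c, namely 1 or 2n - 1
    ([riemann_soliton_ricci], [ricci_soliton_ricci], [ricci_operatorE]).

    Since phi^2 kills xi, the xi-argument of phi^2 (nabla Q) = 0 reads
    c alpha phi^2 (nabla_X xi) = 0; pairing it with a unit vector X orthogonal
    to xi leaves c alpha^2 = 0, so alpha vanishes ([alpha_eq0]).  Now Q = a Id,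
    and phi^2 (nabla Q) = 0 says that X(a) phi^2 Y = 0, so a is constant on the
    connected manifold M ([eigenvalue_constant]); a is a fixed nonzero multiple
    of lambda, and the scalar curvature is (2n + 1) a.  Finally, with alpha = 0,
    the curvature computed from nabla_X xi = - beta phi X yields
    Ric(xi, xi) = 2n beta^2 ([curvature_xi_xi], [ricci_xi_xi]).  Thus beta^2 is
    the constant a / 2n: either beta vanishes identically, which is the
    cosymplectic case, or it vanishes nowhere.  A parallel Q is in particular
    phi^2-parallel, so statement (i) is contained in this argument.

    These pointwise identities are tested on smooth local vector fields with
    prescribed values, so coordinate fields must be shown to be smooth
    ([coordinate_field_smooth], [exists_extension]).  This rests on the chain
    rule for C^k maps ([is_Ck_comp]), hence on the fact that continuous partial
    derivatives imply differentiability ([C1_differentiable]).  Contractions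
    need local orthonormal frames ([exists_orthonormal_frame]), and passing from a
    vanishing derivative to a constant function uses connectedness
    ([is_constant_derive0]). *)

(** * From continuous partial derivatives to total differentiability *)

Lemma is_derive_line (R : realType) (V W : normedModType R) (f : V -> W)
    (y v : V) (s : R) :
  derivable f (s *: v + y) v ->
  is_derive s (1 : R) (fun t : R => f (t *: v + y)) ('D_v f (s *: v + y)).
Proof.
have E : (fun h => h^-1 *: (((fun t : R => f (t *: v + y)) \o shift s) (h *: 1)
            - f (s *: v + y))) =
         (fun h => h^-1 *: ((f \o shift (s *: v + y)) (h *: v)
            - f (s *: v + y))).
  apply/funext => h /=; rewrite [h *: 1]mulr1 scalerDl addrA //.
by move=> df; split; rewrite /derivable /derive E.
Qed.

(** The mean value theorem along a segment, for f minus c times the parameter.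
    The constant c is left free because it serves both with c the derivative at
    a nearby point and with c = 0. *)
Lemma mean_value_segment (R : realType) (V : normedModType R) (f : V -> R)
    (y v : V) (t c e : R) :
  (forall s : R, `|s| <= `|t| ->
     derivable f (s *: v + y) v /\ `|'D_v f (s *: v + y) - c| <= e) ->
  `|f (t *: v + y) - f y - c * t| <= e * `|t|.
Proof.
move=> H; pose g (s : R) := f (s *: v + y).
have dg (s : R) : `|s| <= `|t| -> is_derive s (1 : R) g ('D_v f (s *: v + y)).
  by move=> /H[df _]; exact: is_derive_line.
have cg (s : R) : `|s| <= `|t| -> {for s, continuous g}.
  move=> /dg ?; apply/differentiable_continuous/derivable1_diffP.
  exact: ex_derive.
have step a b : a <= b -> (forall s, s \in `[a, b] -> `|s| <= `|t|) ->
    `|g b - g a - c * (b - a)| <= e * (b - a).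
  move=> ab sab; have [s||s sI ->] := @MVT_segment R g
      (fun s => 'D_v f (s *: v + y)) a b ab.
  - by move=> sI; apply/dg/sab/subset_itv_oo_cc.
  - apply: continuous_in_subspaceT => s; rewrite inE => sI.
    exact/cg/sab/sI.
  - rewrite -mulrBl normrM (ger0_norm (_ : 0 <= b - a)) ?subr_ge0//.
    by apply: ler_wpM2r; rewrite ?subr_ge0//; have [_] := H _ (sab _ sI).
have g0 : g 0 = f y by rewrite /g scale0r add0r.
have [t0|t0] := leP 0 t.
  have := step 0 t t0; rewrite g0 subr0 (ger0_norm t0); apply=> s.
  by rewrite in_itv/= => /andP[s0 st]; rewrite ger0_norm.
have := step t 0 (ltW t0).
have -> : g 0 - g t - c * (0 - t) = - (f (t *: v + y) - f y - c * t).
  by rewrite g0 /g; ring.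
rewrite normrN sub0r (ltr0_norm t0); apply=> s.
rewrite in_itv/= => /andP[s0 st].
by rewrite (ler0_norm st) lerN2.
Qed.

Lemma ler_mx_norm_coord (R : realType) (m : nat) (h : 'rV[R]_m) (j : 'I_m) :
  `|h 0 j| <= `|h|.
Proof.
by rewrite [leRHS]/Num.norm /= mx_normrE; apply: (le_bigmax _ _ (0, j)).
Qed.

Lemma mx_norm_le (R : realType) (m : nat) (h : 'rV[R]_m) (e : R) :
  0 <= e -> (forall j, `|h 0 j| <= e) -> `|h| <= e.
Proof.
move=> e0 H; rewrite [leLHS]/Num.norm /= mx_normrE bigmax_le// => -[i j] _ /=.
by rewrite ord1.
Qed.

(** The first k coordinates of h: these rows are the vertices of a path from 0
    to h whose k-th edge is parallel to the k-th axis. *)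
Definition trunc_row (R : realType) (m : nat) (h : 'rV[R]_m) (k : nat) :
  'rV[R]_m := \row_j (if (j < k)%N then h 0 j else 0).

Lemma trunc_row0 (R : realType) (m : nat) (h : 'rV[R]_m) : trunc_row h 0 = 0.
Proof. by apply/rowP => j; rewrite !mxE. Qed.

Lemma trunc_row_full (R : realType) (m : nat) (h : 'rV[R]_m) :
  trunc_row h m = h.
Proof. by apply/rowP => j; rewrite !mxE ltn_ord. Qed.

Lemma trunc_rowS (R : realType) (m : nat) (h : 'rV[R]_m) (k : 'I_m) :
  trunc_row h k.+1 = h 0 k *: delta_mx 0 k + trunc_row h k.
Proof.
apply/rowP => j; rewrite !mxE eqxx /= ltnS leq_eqVlt -val_eqE /=.
by have [/val_inj ->|_] := eqVneq (val j) (val k);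
  rewrite ?ltnn ?mulr1 ?addr0 // mulr0 add0r.
Qed.

(** The staircase path from 0 to h never leaves the ball of radius |h| for the
    sup norm, so estimates valid near x apply along the whole path. *)
Lemma trunc_row_ball (R : realType) (m : nat) (h : 'rV[R]_m) (k : 'I_m)
    (s : R) :
  `|s| <= `|h 0 k| -> `|s *: delta_mx 0 k + trunc_row h k| <= `|h|.
Proof.
move=> sh; apply: mx_norm_le => // j; rewrite !mxE eqxx /=.
have [->|jk] := eqVneq j k.
  by rewrite ltnn mulr1 addr0 (le_trans sh)// ler_mx_norm_coord.
rewrite mulr0 add0r; case: ifP => _; last by rewrite normr0.
exact: ler_mx_norm_coord.
Qed.

(** Telescoping f along the staircase path from x to x + h leaves one increment
    per axis, and the mean value theorem compares each of them with the partial
    derivative at x. *)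
Lemma C1_linear_approx (R : realType) (m : nat) (f : 'rV[R]_m -> R)
    (x h : 'rV[R]_m) (e : R) :
  (forall k y, `|y - x| <= `|h| -> derivable f y (delta_mx 0 k) /\
    `|'D_(delta_mx 0 k) f y - 'D_(delta_mx 0 k) f x| <= e) ->
  `|f (h + x) - f x - \sum_k h 0 k * 'D_(delta_mx 0 k) f x|
    <= (m%:R * e) * `|h|.
Proof.
move=> H.
have -> : f (h + x) - f x = \sum_(k < m)
    (f (trunc_row h k.+1 + x) - f (trunc_row h k + x)).
  rewrite -(big_mkord xpredT
    (fun k => f (trunc_row h k.+1 + x) - f (trunc_row h k + x))).
  by rewrite telescope_sumr // trunc_row_full trunc_row0 add0r.
rewrite -sumrB; apply: le_trans (ler_norm_sum _ _ _) _.
rewrite -mulrA mulr_natl -[X in _ <= _ *+ X](card_ord m) -sumr_const.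
apply: ler_sum => k _.
rewrite trunc_rowS -[_ + trunc_row h k + x]addrA [h 0 k * _]mulrC.
apply: (@le_trans _ _ (e * `|h 0 k|)).
  apply: mean_value_segment => s sh; apply: H.
  by rewrite addrA addrK; exact: trunc_row_ball.
apply: ler_wpM2l; last exact: ler_mx_norm_coord.
have [|_] := H k x; first by rewrite subrr normr0.
exact: le_trans.
Qed.

(** By continuity of the partial derivatives, the constant of the previous
    estimate can be made arbitrarily small near x. *)
Lemma C1_differentiable (R : realType) (m : nat) (O : set 'rV[R]_m)
    (f : 'rV[R]_m -> R^o) (x : 'rV[R]_m) :
  open O -> is_Ck 1 O f -> O x -> differentiable f x.
Proof.
move=> oO [_ C1] Ox.
pose L (h : 'rV[R]_m) : R^o := \sum_k h 0 k * 'D_(delta_mx 0 k) f x.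
have linL : linear L.
  move=> a u v; rewrite /L scaler_sumr -big_split /=; apply: eq_bigr => k _.
  by rewrite !mxE mulrDl -mulrA.
pose LL : {linear 'rV[R]_m -> R^o} :=
  HB.pack L (GRing.isLinear.Build R _ _ _ L linL).
have cL : continuous LL.
  move=> h; apply: differentiable_continuous.
  have -> : (LL : _ -> _) = \sum_k (fun h : 'rV[R]_m =>
      h 0 k * 'D_(delta_mx 0 k) f x).
    by apply/funext => y; rewrite fct_sumE.
  apply: differentiable_sum => k; apply: differentiableM => //.
  exact: differentiable_coord.
have approx : f \o shift x = cst (f x) + (LL : 'rV[R]_m -> R^o)
    +o_ (0 : 'rV[R]_m) (id : 'rV[R]_m -> 'rV[R]_m).
  apply/eqaddoP => e e0.
  (* m.+1 rather than m, so that d is positive also when m = 0 *)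
  pose d := e / m.+1%:R.
  have d0 : 0 < d by rewrite divr_gt0// ltr0n.
  have : \forall y \near x, forall k : 'I_m, O y /\
      `|'D_(delta_mx 0 k) f y - 'D_(delta_mx 0 k) f x| <= d.
    apply: (@filter_forall _ 'I_m _ (nbhs x) (nbhs_filter x)) => k.
    have nO : \forall y \near x, O y by exact: open_nbhs_nbhs.
    have [_ [+ _]] := C1 k.
    move=> /(_ x Ox)/cvgrPdist_le/(_ d d0); apply: filterS2 nO => y Oy.
    by rewrite distrC.
  move=> /nbhs_ballP[r /= r0 br].
  have := @pseudometric_normed_Zmodule.nbhs0_lt R 'rV[R]_m r r0.
  apply: filterS => h hr.
  rewrite /= -![(_ + _ : _ -> _) _]/(_ + _) -![(- _ : _ -> _) _]/(- _).
  rewrite opprD addrA /cst.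
  apply: le_trans (@C1_linear_approx _ _ f x h d _) _.
    move=> k y yx; have yb : ball x r y.
      by rewrite -ball_normE /ball_/= distrC (le_lt_trans yx).
    have [Oy ?] := br _ yb k; split=> //.
    by have [+ _] := C1 k; apply.
  apply: ler_wpM2r => //; rewrite /d mulrCA; apply: ler_piMr; first exact: ltW.
  by rewrite ler_pdivrMr ?ltr0n// mul1r ler_nat.
have dE := diff_unique cL approx.
by apply/diff_locallyP; rewrite dE.
Qed.

(** * Closure properties of C^k maps on open subsets of R^m *)

Lemma near_eq_continuous (T U : topologicalType) (f g : T -> U) (x : T) :
  (\forall y \near x, f y = g y) -> {for x, continuous f} ->
  {for x, continuous g}.
Proof.
move=> fg cf; rewrite /prop_for /continuous_at -(nbhs_singleton fg).
by apply: cvg_trans cf; exact: near_eq_cvg.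
Qed.

Lemma derive_comp (R : numFieldType) (U V W : normedModType R) (f : U -> V)
    (g : V -> W) (x v : U) :
  differentiable f x -> differentiable g (f x) ->
  'D_v (g \o f) x = 'D_('D_v f x) g (f x).
Proof.
move=> df dg; rewrite !deriveE//; last exact: differentiable_comp.
by rewrite diff_comp.
Qed.

Lemma row_continuous (R : realType) (T : topologicalType) (p : nat)
    (g : T -> 'rV[R]_p) (x : T) :
  (forall j, {for x, continuous (fun y => g y 0 j : R^o)}) ->
  {for x, continuous g}.
Proof.
move=> cg; apply/cvgrPdist_le => e e0.
have : forall j, \forall y \near x, `|g x 0 j - g y 0 j| <= e.
  by move=> j; have /cvgrPdist_le/(_ e e0) := cg j.
move=> /(@filter_forall _ 'I_p _ (nbhs x) (nbhs_filter x)).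
apply: filterS => y H; apply: mx_norm_le; first exact: ltW.
by move=> j; rewrite !mxE; exact: H.
Qed.

Section CkAlgebra.
Context (R : realType) (m : nat).
Implicit Types (O : set 'rV[R]_m) (W : normedModType R).

Lemma is_Ck_continuous W k O (f : 'rV[R]_m -> W) x :
  is_Ck k O f -> O x -> {for x, continuous f}.
Proof. by case: k => [|k] [+ _] => /[apply]. Qed.

Lemma is_CkW W k O (f : 'rV[R]_m -> W) : is_Ck k.+1 O f -> is_Ck k O f.
Proof.
elim: k f => [|k IH] f [cf Hf]; split=> // i.
by have [df Df] := Hf i; split=> //; exact: IH.
Qed.

Lemma is_Ck_C1 W k O (f : 'rV[R]_m -> W) : is_Ck k.+1 O f -> is_Ck 1 O f.
Proof. by elim: k => // k IH /is_CkW. Qed.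

Lemma is_Ck_subset W k O O' (f : 'rV[R]_m -> W) :
  O' `<=` O -> is_Ck k O f -> is_Ck k O' f.
Proof.
move=> OO; elim: k f => [|k IH] f [cf Hf]; split=> //; try by move=> x /OO/cf.
by move=> i; have [df Df] := Hf i; split=> [x /OO/df//|]; exact: IH.
Qed.

Lemma is_Ck_congr W k O (f g : 'rV[R]_m -> W) :
  open O -> (forall x, O x -> f x = g x) -> is_Ck k O f -> is_Ck k O g.
Proof.
move=> oO; have near_fg (f' g' : 'rV[R]_m -> W) x :
    (forall x, O x -> f' x = g' x) -> O x -> \forall y \near x, f' y = g' y.
  by move=> fg Ox; apply: filterS fg _; exact: open_nbhs_nbhs.
elim: k f g => [|k IH] f g fg [cf Hf]; (split; [move=> x Ox|]) => //.
1,2: exact: near_eq_continuous (near_fg _ _ _ fg Ox) (cf x Ox).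
move=> i; have [df Df] := Hf i; split.
  by move=> x Ox; exact: near_eq_derivable (near_fg _ _ _ fg Ox) (df x Ox).
by apply: IH Df => x Ox; exact: near_eq_derive (near_fg _ _ _ fg Ox).
Qed.

Lemma is_Ck_cst W k O (w : W) : is_Ck k O (fun=> w).
Proof.
elim: k w => [|k IH] w; split=> //;
  try by move=> x _; exact: (@cst_continuous _ _ w x).
move=> i; split=> [x _|]; first exact: (@derivable_cst _ _ _ w x).
rewrite (_ : 'D__ _ = fun=> 0); first exact: IH.
by apply/funext => x; exact: (@derive_cst _ _ _ w x).
Qed.

Lemma is_CkD W k O (f g : 'rV[R]_m -> W) : open O ->
  is_Ck k O f -> is_Ck k O g -> is_Ck k O (fun x => f x + g x).
Proof.
move=> oO; elim: k f g => [|k IH] f g [cf Hf] [cg Hg]; split=> //.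
1,2: by move=> x Ox; exact: (continuousD (cf x Ox) (cg x Ox)).
move=> i; have [df Df] := Hf i; have [dg Dg] := Hg i; split=> [x Ox|].
  by apply: derivableD; [exact: df|exact: dg].
apply: is_Ck_congr (IH _ _ Df Dg) => // x Ox.
by rewrite deriveD//; [exact: df|exact: dg].
Qed.

Lemma is_CkM k O (f g : 'rV[R]_m -> R^o) : open O ->
  is_Ck k O f -> is_Ck k O g -> is_Ck k O (fun x => f x * g x : R^o).
Proof.
move=> oO; elim: k f g => [|k IH] f g kf kg.
all: have cfg x : O x -> {for x, continuous (fun x => f x * g x : R^o)} by
  move=> Ox; exact: (continuousM (is_Ck_continuous kf Ox)
                                 (is_Ck_continuous kg Ox)).
all: split=> // i; have [_ /(_ i) [df Df]] := kf; have [_ /(_ i) [dg Dg]] := kg.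
split=> [x Ox|]; first by apply: derivableM; [exact: df|exact: dg].
apply: is_Ck_congr
  (is_CkD oO (IH _ _ (is_CkW kf) Dg) (IH _ _ (is_CkW kg) Df)) => //.
by move=> x Ox; rewrite deriveM//; [exact: df|exact: dg].
Qed.

Lemma is_Ck_sum W k O (I : Type) (r : seq I) (f : I -> 'rV[R]_m -> W) :
  open O ->
  (forall i, is_Ck k O (f i)) -> is_Ck k O (fun x => \sum_(i <- r) f i x).
Proof.
move=> oO H; elim: r => [|i r IH].
  by under eq_fun do rewrite big_nil; exact: is_Ck_cst.
by under eq_fun do rewrite big_cons; exact: is_CkD.
Qed.

(** Real powers are what normalizing a vector field requires; all exponents are
    treated at once because differentiation lowers the exponent by one. *)
Lemma is_Ck_powR k O (f : 'rV[R]_m -> R^o) (a : R) : open O ->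
  (forall x, O x -> 0 < f x) -> is_Ck k O f ->
  is_Ck k O (fun x => f x `^ a : R^o).
Proof.
move=> oO f0; elim: k a f f0 => [|k IH] a f f0 kf.
all: have cfa x : O x -> {for x, continuous (fun x => f x `^ a : R^o)} by
  move=> Ox; apply: (@continuous_comp _ _ _ f (fun t => t `^ a));
  [exact: is_Ck_continuous kf Ox|
   apply/differentiable_continuous/derivable1_diffP;
   apply: ex_derive; apply: is_derive1_powR; exact: f0].
all: split=> // i; have [_ /(_ i) [df Df]] := kf.
have dp x : O x -> is_derive (f x) (1 : R) (fun t : R => t `^ a : R)
    (a * f x `^ (a - 1)) by move=> Ox; apply: is_derive1_powR; exact: f0.
have diff_p x : O x -> differentiable (fun t : R => t `^ a : R) (f x).
  by move=> /dp ?; apply/derivable1_diffP.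
have diff_f x : O x -> differentiable f x.
  by move=> Ox; exact: C1_differentiable oO (is_Ck_C1 kf) Ox.
split=> [x Ox|].
  apply: diff_derivable.
  exact: (@differentiable_comp _ _ _ _ f _ x (diff_f x Ox) (diff_p x Ox)).
have kp := IH (a - 1) f f0 (is_CkW kf).
apply: is_Ck_congr
  (is_CkM oO (is_CkM oO (is_Ck_cst k O (a : R^o)) kp) Df) => //.
move=> x Ox /=.
rewrite (@derive_comp _ _ _ _ f (fun t : R => t `^ a) x _
  (diff_f x Ox) (diff_p x Ox)).
rewrite [RHS]deriveE; last exact: diff_p.
have [pa <-] := dp x Ox.
by rewrite -derive1E deriv1E // mulrC.
Qed.

(** Reduces vector-valued maps to scalar ones, for which products, the mean
    value theorem and the chain rule are available. *)
Lemma is_Ck_rowP p k O (f : 'rV[R]_m -> 'rV[R]_p) : open O ->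
  is_Ck k O f <-> forall j, is_Ck k O (fun x => f x 0 j : R^o).
Proof.
move=> oO.
have der_coord (g : 'rV[R]_m -> 'rV[R]_p) x v j : derivable g x v ->
    ('D_v g x) 0 j = 'D_v (fun y => g y 0 j : R^o) x.
  by move=> dg; rewrite derive_mx// mxE.
split.
  elim: k f => [|k IH] f [cf Hf] j; (split; [move=> x Ox|]) => //.
  1,2: exact: (continuous_comp (cf x Ox) (@coord_continuous _ _ _ 0 j (f x))).
  move=> i; have [df Df] := Hf i; split=> [x Ox|].
    by have /derivable_mxP := df x Ox; apply.
  by apply: is_Ck_congr (IH _ Df j) => // x Ox; rewrite der_coord//; exact: df.
elim: k f => [|k IH] f Hf; (split; [move=> x Ox|]) => //.
1,2: by apply: row_continuous => j; have [+ _] := Hf j; apply.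
move=> i.
have df x : O x -> derivable f x (delta_mx 0 i).
  move=> Ox; apply/derivable_mxP => a j; rewrite ord1.
  by have [_ /(_ i)[+ _]] := Hf j; apply.
split=> //; apply: IH => j; have [_ /(_ i)[_ Dj]] := Hf j.
by apply: is_Ck_congr Dj => // x Ox; rewrite der_coord//; exact: df.
Qed.

Lemma C1_differentiable_row p O (f : 'rV[R]_m -> 'rV[R]_p) x :
  open O -> is_Ck 1 O f -> O x -> differentiable f x.
Proof.
move=> oO /(is_Ck_rowP _ _ oO) Hf Ox.
have -> : f = \sum_j (fun y => f y 0 j *: delta_mx 0 j).
  by apply/funext => y; rewrite fct_sumE [LHS]row_sum_delta.
apply: differentiable_sum => j; apply: differentiableZl.
exact: C1_differentiable oO (Hf j) Ox.
Qed.

Lemma is_CkZ p k O (f : 'rV[R]_m -> R^o) (g : 'rV[R]_m -> 'rV[R]_p) : open O ->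
  is_Ck k O f -> is_Ck k O g -> is_Ck k O (fun x => f x *: g x).
Proof.
move=> oO kf /(is_Ck_rowP _ _ oO) kg; apply/is_Ck_rowP => // j.
under eq_fun do rewrite mxE.
exact: is_CkM.
Qed.
End CkAlgebra.

Lemma row_derive_sum (R : realType) (m : nat) (W : normedModType R)
    (f : 'rV[R]_m -> W) (x v : 'rV[R]_m) : differentiable f x ->
  'D_v f x = \sum_j v 0 j *: 'D_(delta_mx 0 j) f x.
Proof.
move=> df; rewrite deriveE// [in LHS](row_sum_delta v) linear_sum.
by apply: eq_bigr => j _; rewrite linearZ deriveE.
Qed.

(** Induction on k: the chain rule writes the i-th partial derivative of the
    composite as a sum of products of C^k maps, each containing a partial
    derivative of f composed with g; that one is C^k by induction. *)
Lemma is_Ck_comp (R : realType) (m p k : nat) (O : set 'rV[R]_m)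
    (O' : set 'rV[R]_p) (f : 'rV[R]_p -> R^o) (g : 'rV[R]_m -> 'rV[R]_p) :
  open O -> open O' -> (forall x, O x -> O' (g x)) ->
  is_Ck k O' f -> is_Ck k O g -> is_Ck k O (f \o g).
Proof.
move=> oO oO' gO; elim: k f => [|k IH] f kf kg; (split; [move=> x Ox|]) => //.
1,2: exact: (continuous_comp (is_Ck_continuous kg Ox)
    (is_Ck_continuous kf (gO _ Ox))).
move=> i; have df x : O x -> differentiable f (g x).
  by move=> /gO; exact: C1_differentiable oO' (is_Ck_C1 kf).
have dg x : O x -> differentiable g x.
  exact: C1_differentiable_row oO (is_Ck_C1 kg).
split=> [x Ox|].
  exact: diff_derivable (differentiable_comp (dg x Ox) (df x Ox)).
have [_ /(_ i)[_ Dg]] := kg.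
have Dgj := (is_Ck_rowP _ _ oO).1 Dg.
have S := is_Ck_sum (index_enum 'I_p) oO 
  (fun j => is_CkM oO (Dgj j) (IH _ (kf.2 j).2 (is_CkW kg))).
apply: is_Ck_congr S => // x Ox.
by rewrite [RHS](derive_comp _ (dg x Ox) (df x Ox)) (row_derive_sum _ (df x Ox)).
Qed.

Lemma is_Ck_comp_row (R : realType) (m p q k : nat) (O : set 'rV[R]_m)
    (O' : set 'rV[R]_p) (f : 'rV[R]_p -> 'rV[R]_q) (g : 'rV[R]_m -> 'rV[R]_p) :
  open O -> open O' -> (forall x, O x -> O' (g x)) ->
  is_Ck k O' f -> is_Ck k O g -> is_Ck k O (f \o g).
Proof.
move=> oO oO' gO /(is_Ck_rowP _ _ oO') kf kg; apply/is_Ck_rowP => // j.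
exact: is_Ck_comp oO oO' gO (kf j) kg.
Qed.

Lemma is_Ck_derive_dir (R : realType) (m p k : nat) (O : set 'rV[R]_m)
    (f : 'rV[R]_m -> 'rV[R]_p) (v : 'rV[R]_m) : open O ->
  is_Ck k.+1 O f -> is_Ck k O ('D_v f).
Proof.
move=> oO kf.
have S := is_Ck_sum (index_enum 'I_m) oO
  (fun j => is_CkZ oO (is_Ck_cst k O (v 0 j : R^o)) (kf.2 j).2).
apply: is_Ck_congr S => // x Ox; rewrite row_derive_sum//.
exact: C1_differentiable_row oO (is_Ck_C1 kf) Ox.
Qed.

(** * Derivatives on a manifold and coordinate vector fields *)

(** Balls are convex, so the mean value estimate with c = 0 and e = 0 applies on
    the segment that joins x to any point of a ball around it. *)
Lemma locally_constant_derive0 (R : realType) (m : nat) (O : set 'rV[R]_m)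
    (f : 'rV[R]_m -> R) (x : 'rV[R]_m) : open O -> O x ->
  (forall y v, O y -> derivable f y v /\ 'D_v f y = 0) ->
  \forall y \near x, f y = f x.
Proof.
move=> oO Ox H.
have /nbhs_ballP[r /= r0 br] : nbhs x O by exact: open_nbhs_nbhs.
apply/nbhs_ballP; exists r => // y xy.
have := @mean_value_segment R _ f x (y - x) 1 0 0.
rewrite scale1r subrK mul0r subr0 mul0r => F.
apply/eqP; rewrite -subr_eq0 -normr_le0; apply: F => s; rewrite normr1 => s1.
have Os : O (s *: (y - x) + x).
  apply: br; move: xy; rewrite -!ball_normE /ball_/= => xy.
  rewrite opprD addrCA subrr addr0 normrN normrZ (le_lt_trans _ xy)//.
  by rewrite distrC ler_piMl.
by have [? ->] := H _ (y - x) Os; rewrite subr0 normr0.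
Qed.

Section ManifoldCalculus.
Context (R : realType) (m : nat) (M : manifold R m).
Implicit Types (U V : set M) (c : chart R m M) (p q : M) (X Y : vfield M)
  (W : normedModType R).

Lemma cimage_open c U : open U -> open (cmap c @` (U `&` cdom c)).
Proof.
move=> oU; rewrite openE => x [p [Up cp] <-]; rewrite /interior.
have oUc : open (U `&` cdom c) by apply: openI => //; exact: cdom_open.
have icp : (cmap c @` cdom c) (cmap c p) by exists p.
have N1 : nbhs (cmap c p) (cmap c @` cdom c).
  by apply: open_nbhs_nbhs; split => //; exact: cimg_open.
have N2 : nbhs (cmap c p) (cinv c @^-1` (U `&` cdom c)).
  apply: cinv_continuous => //; rewrite cmapK//.
  exact: open_nbhs_nbhs.
apply: filterS2 N1 N2 => y [q cq <-]; rewrite /preimage/= cmapK// => -[Uq _].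
by exists q.
Qed.

Lemma is_Cinfty_subset W (O O' : set 'rV[R]_m) (f : 'rV[R]_m -> W) :
  O' `<=` O -> is_Cinfty O f -> is_Cinfty O' f.
Proof. by move=> OO H k; exact: is_Ck_subset OO (H k). Qed.

Lemma transition_differentiable c c' p : atlas c -> atlas c' -> cdom c p ->
  cdom c' p -> differentiable (cmap c' \o cinv c) (cmap c p).
Proof.
move=> ac ac' cp c'p.
have oO : open (cmap c @` (cdom c' `&` cdom c)).
  by apply: cimage_open; exact: cdom_open.
apply: (C1_differentiable_row oO _); last by exists p.
by rewrite setIC; exact: (atlas_smooth ac ac').
Qed.

Lemma near_chart c p (P : 'rV[R]_m -> Prop) (U : set M) :
  open U -> U p -> cdom c p ->
  (forall q, U q -> cdom c q -> P (cmap c q)) -> \forall x \near cmap c p, P x.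
Proof.
move=> oU Up cp H; apply: filterS (_ : nbhs _ (cmap c @` (U `&` cdom c))).
  by move=> x [q [Uq cq] <-]; exact: H.
by apply: open_nbhs_nbhs; split; [exact: cimage_open|exists p].
Qed.

(** Tangent vectors are given in the preferred chart of their base point, while
    smoothness is tested in a fixed chart; the chain rule for the transition map
    translates between the two. *)
Lemma tderive_chart W c (F : M -> W) p v : atlas c -> cdom c p ->
  differentiable (F \o cinv c) (cmap c p) ->
  tderive F p v = 'D_(tderive (cmap c) p v) (F \o cinv c) (cmap c p).
Proof.
move=> ac cp dF; rewrite /tderive.
have acp := chart_at_atlas p; have cpp := chart_at_dom p.
set c0 := chart_at p in acp cpp *.
have E : (cmap c \o cinv c0) (cmap c0 p) = cmap c p by rewrite /= cmapK.
rewrite -[in RHS]E -derive_comp; first last.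
- by rewrite E.
- exact: transition_differentiable.
apply: near_eq_derive; apply: (near_chart (@cdom_open _ _ _ c)) => // q cq c0q.
by rewrite /= !cmapK.
Qed.

Lemma tderive_linear c p a u v : atlas c -> cdom c p ->
  tderive (cmap c) p (a *: u + v) =
  a *: tderive (cmap c) p u + tderive (cmap c) p v.
Proof.
move=> ac cp; rewrite /tderive.
have := transition_differentiable (chart_at_atlas p) ac (chart_at_dom p) cp.
by move=> d; rewrite !deriveE// linearP.
Qed.

(** The field with constant components v in the chart c, rewritten in the
    preferred chart of each point. *)
Definition coordinate_field c (v : 'rV[R]_m) : vfield M := fun q =>
  'D_v (cmap (chart_at q) \o cinv c) (cmap c q).

(** The two transition maps are inverse to each other, hence so are their
    differentials. *)
Lemma derive_transitionK c c' p v : atlas c -> atlas c' ->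
  cdom c p -> cdom c' p ->
  'D_('D_v (cmap c' \o cinv c) (cmap c p)) (cmap c \o cinv c') (cmap c' p) = v.
Proof.
move=> ac ac' cp c'p.
have E : (cmap c' \o cinv c) (cmap c p) = cmap c' p by rewrite /= cmapK.
rewrite -[in LHS]E -derive_comp; first last.
- by rewrite E; exact: transition_differentiable.
- exact: transition_differentiable.
rewrite -[RHS](derive_id (cmap c p)).
apply: near_eq_derive; apply: (near_chart (@cdom_open _ _ _ c')) => // q c'q cq.
by rewrite /= !cmapK.
Qed.

Lemma tderive_coordinate_field W c (F : M -> W) v p : atlas c -> cdom c p ->
  differentiable (F \o cinv c) (cmap c p) ->
  tderive F p (coordinate_field c v p) = 'D_v (F \o cinv c) (cmap c p).
Proof.
move=> ac cp dF; rewrite (tderive_chart _ ac)//; congr ('D_ _ _ _).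
apply: derive_transitionK => //; [exact: chart_at_atlas|exact: chart_at_dom].
Qed.

Lemma coordinate_field_at p v : coordinate_field (chart_at p) v p = v.
Proof.
rewrite /coordinate_field -[RHS](derive_id (cmap (chart_at p) p)).
apply: near_eq_derive.
apply: (near_chart (@cdom_open _ _ _ (chart_at p)));
  try exact: chart_at_dom.
by move=> q cq _; rewrite /= cmapK.
Qed.

(** In a second chart c', read in a third chart c2, the components are the
    derivative along v of the transition map from c to c', composed with the
    transition map from c2 to c. *)
Lemma coordinate_field_smooth c v : atlas c ->
  smooth_vfield (cdom c) (coordinate_field c v).
Proof.
move=> ac c' ac' c2 ac2 k.
have oU : open (cdom c `&` cdom c') by apply: openI; exact: cdom_open.
have oO : open (cmap c2 @` (cdom c `&` cdom c' `&` cdom c2)).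
  exact: cimage_open.
have oO' : open (cmap c @` (cdom c' `&` cdom c)).
  by apply: cimage_open; exact: cdom_open.
have Dk : is_Ck k (cmap c @` (cdom c' `&` cdom c)) ('D_v (cmap c' \o cinv c)).
  apply: (is_Ck_derive_dir _ oO'); rewrite setIC.
  exact: (atlas_smooth ac ac' k.+1).
have Tk : is_Ck k (cmap c2 @` (cdom c `&` cdom c' `&` cdom c2))
    (cmap c \o cinv c2).
  apply: (is_Ck_subset _ (atlas_smooth ac2 ac k)).
  by move=> x [p [[cp _] c2p] <-]; exists p.
apply: (is_Ck_congr oO _ (is_Ck_comp_row oO oO' _ Dk Tk)); last first.
  by move=> x [p [[cp c'p] c2p] <-]; exists p => //=; rewrite cmapK.
move=> x [p [[cp c'p] c2p] <-]; rewrite /= cmapK//.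
rewrite /components /along tderive_coordinate_field//.
exact: transition_differentiable.
Qed.

End ManifoldCalculus.

(** * Smooth functions and vector fields on open subsets *)

Section SmoothFields.
Context (R : realType) (m : nat) (M : manifold R m).
Implicit Types (U V : set M) (c : chart R m M) (p q : M) (X Y : vfield M)
  (W : normedModType R).

Lemma smooth_on_subset W U V (f : M -> W) :
  V `<=` U -> smooth_on U f -> smooth_on V f.
Proof.
move=> VU sf c ac; apply: is_Cinfty_subset (sf c ac).
by move=> x [p [/VU Up cp] <-]; exists p.
Qed.

Lemma smooth_on_congr W U (f g : M -> W) : open U ->
  (forall p, U p -> f p = g p) -> smooth_on U f -> smooth_on U g.
Proof.
move=> oU fg sf c ac k.
apply: (is_Ck_congr (cimage_open oU) _ (sf c ac k)).
by move=> x [p [Up cp] <-]; rewrite /= cmapK// fg.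
Qed.

Lemma smooth_on_cst W U (w : W) : smooth_on U (fun=> w).
Proof. by move=> c ac k; exact: is_Ck_cst. Qed.

Lemma smooth_onD W U (f g : M -> W) : open U ->
  smooth_on U f -> smooth_on U g -> smooth_on U (fun p => f p + g p).
Proof.
move=> oU sf sg c ac k.
exact: (is_CkD (cimage_open oU) (sf _ ac _) (sg _ ac _)).
Qed.

Lemma smooth_onZ (d : nat) U (f : M -> R^o) (g : M -> 'rV[R]_d) : open U ->
  smooth_on U f -> smooth_on U g -> smooth_on U (fun p => f p *: g p).
Proof.
move=> oU sf sg c ac k.
exact: (is_CkZ (cimage_open oU) (sf _ ac _) (sg _ ac _)).
Qed.

Lemma smooth_onM U (f g : M -> R^o) : open U ->
  smooth_on U f -> smooth_on U g -> smooth_on U (fun p => f p * g p : R^o).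
Proof.
move=> oU sf sg c ac k.
exact: (is_CkM (cimage_open oU) (sf _ ac _) (sg _ ac _)).
Qed.

Lemma smooth_onN U (f : M -> R^o) : open U ->
  smooth_on U f -> smooth_on U (fun p => - f p : R^o).
Proof.
move=> oU sf; apply: (smooth_on_congr oU _
  (smooth_onM oU (@smooth_on_cst _ U (-1 : R^o)) sf)).
by move=> p _; rewrite mulN1r.
Qed.

Lemma smooth_on_powR U (f : M -> R^o) (a : R) : open U ->
  (forall p, U p -> 0 < f p) -> smooth_on U f ->
  smooth_on U (fun p => f p `^ a : R^o).
Proof.
move=> oU f0 sf c ac k.
apply: (@is_Ck_powR _ _ _ _ (f \o cinv c) a (cimage_open oU) _ (sf _ ac _)).
by move=> x [p [Up cp] <-]; rewrite /= cmapK//; exact: f0.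
Qed.

Lemma smooth_on_continuous W U (f : M -> W) p : open U -> smooth_on U f -> U p ->
  {for p, continuous f}.
Proof.
move=> oU sf Up; have ac := chart_at_atlas p; have cp := chart_at_dom p.
set c := chart_at p in ac cp.
have cf : {for cmap c p, continuous (f \o cinv c)}.
  by apply: (is_Ck_continuous (sf c ac 0)); exists p.
have := continuous_comp (cmap_continuous cp) cf.
apply: near_eq_continuous.
apply: filterS (_ : nbhs p (cdom c)); first by move=> q cq; rewrite /= cmapK.
by apply: open_nbhs_nbhs; split => //; exact: cdom_open.
Qed.

Lemma smooth_on_differentiable U c (f : M -> R^o) p : atlas c -> open U ->
  smooth_on U f -> U p -> cdom c p -> differentiable (f \o cinv c) (cmap c p).
Proof.
move=> ac oU sf Up cp.
by apply: (C1_differentiable (cimage_open oU) (sf c ac 1)); exists p.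
Qed.

(** A derivation is local: this is what makes covariant derivatives local. *)
Lemma tderive_near W (f g : M -> W) p v : (\forall q \near p, f q = g q) ->
  tderive f p v = tderive g p v.
Proof.
move=> fg; apply: near_eq_derive.
have cp := chart_at_dom p.
have icp : (cmap (chart_at p) @` cdom (chart_at p)) (cmap (chart_at p) p).
  by exists p.
have := cinv_continuous icp; rewrite /prop_for /continuous_at cmapK//.
by move=> /(_ _ fg).
Qed.

Lemma tderive_cst W (w : W) p v : tderive (fun=> w) p v = 0.
Proof. exact: (@derive_cst _ _ _ w). Qed.

Lemma smooth_vfield_subset U V X :
  V `<=` U -> smooth_vfield U X -> smooth_vfield V X.
Proof.
move=> VU sX c ac; apply: smooth_on_subset (sX c ac).
by move=> p [/VU].
Qed.

Lemma smooth_vfieldIl U V X : smooth_vfield U X -> smooth_vfield (U `&` V) X.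
Proof. by apply: smooth_vfield_subset => q []. Qed.

Lemma smooth_vfieldIr U V X : smooth_vfield V X -> smooth_vfield (U `&` V) X.
Proof. by apply: smooth_vfield_subset => q []. Qed.

Lemma smooth_vfield_congr U X Y : open U ->
  (forall p, U p -> X p = Y p) -> smooth_vfield U X -> smooth_vfield U Y.
Proof.
move=> oU XY sX c ac; apply: (smooth_on_congr _ _ (sX c ac)).
  by apply: openI => //; exact: cdom_open.
by move=> p [Up _]; rewrite /components /along XY.
Qed.

Lemma smooth_vfieldDZ U (f : M -> R^o) X Y : open U -> smooth_on U f ->
  smooth_vfield U X -> smooth_vfield U Y ->
  smooth_vfield U (fun p => f p *: X p + Y p).
Proof.
move=> oU sf sX sY c ac.
have oUc : open (U `&` cdom c) by apply: openI => //; exact: cdom_open.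
have sf' : smooth_on (U `&` cdom c) f by apply: smooth_on_subset sf => p [].
apply: (smooth_on_congr oUc _
  (smooth_onD oUc (smooth_onZ oUc sf' (sX c ac)) (sY c ac))).
by move=> p [Up cp]; rewrite /components /along tderive_linear.
Qed.

Lemma smooth_vfield0 U : open U -> smooth_vfield U (fun=> 0).
Proof.
move=> oU c ac.
have oUc : open (U `&` cdom c) by apply: openI => //; exact: cdom_open.
apply: (smooth_on_congr oUc _
  (@smooth_on_cst _ (U `&` cdom c) (0 : 'rV[R]_m))).
by move=> p [Up cp]; rewrite /components /along /tderive derive0.
Qed.

Lemma smooth_vfieldZ U (f : M -> R^o) X : open U -> smooth_on U f ->
  smooth_vfield U X -> smooth_vfield U (fun p => f p *: X p).
Proof.
move=> oU sf sX.
apply: (smooth_vfield_congr oU _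
  (smooth_vfieldDZ oU sf sX (smooth_vfield0 oU))).
by move=> p _; rewrite addr0.
Qed.

Lemma smooth_vfieldD U X Y : open U -> smooth_vfield U X -> smooth_vfield U Y ->
  smooth_vfield U (fun p => X p + Y p).
Proof.
move=> oU sX sY.
apply: (smooth_vfield_congr oU _
  (smooth_vfieldDZ oU (@smooth_on_cst _ U (1 : R^o)) sX sY)).
by move=> p _; rewrite scale1r.
Qed.

Lemma smooth_vfield_sum U (I : Type) (r : seq I) (X : I -> vfield M) : open U ->
  (forall i, smooth_vfield U (X i)) ->
  smooth_vfield U (fun p => \sum_(i <- r) X i p).
Proof.
move=> oU H; elim: r => [|i r IH].
  by under eq_fun do rewrite big_nil; exact: smooth_vfield0.
under eq_fun do rewrite big_cons.
exact: (smooth_vfieldD oU (H i) IH).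
Qed.

(** Testing the hypothesis on coordinate fields shows that f is locally constant
    in every chart; its level sets are then open and closed. *)
Lemma is_constant_derive0 (f : M -> R) : smooth_function f ->
  (forall U X p, open U -> smooth_vfield U X -> U p ->
     along X (f : M -> R^o) p = 0) ->
  is_constant f.
Proof.
move=> sf H.
have loc p : \forall q \near p, f q = f p.
  have ac := chart_at_atlas p; have cp := chart_at_dom p.
  set c := chart_at p in ac cp.
  pose O := cmap c @` (setT `&` cdom c).
  have oO : open O by apply: cimage_open; exact: openT.
  have Op : O (cmap c p) by exists p.
  have h0 y v : O y -> derivable (f \o cinv c) y v /\ 'D_v (f \o cinv c) y = 0.
    move=> [q [_ cq] <-].
    have dq := smooth_on_differentiable ac openT sf (I : setT q) cq.
    split; first exact: diff_derivable.
    rewrite -tderive_coordinate_field//.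
    exact: H (@cdom_open _ _ _ c) (@coordinate_field_smooth _ _ _ c v ac) cq.
  have N1 : \forall q \near p, f (cinv c (cmap c q)) = f (cinv c (cmap c p)).
    exact: (cmap_continuous cp (locally_constant_derive0 oO Op h0)).
  have N2 : nbhs p (cdom c).
    by apply: open_nbhs_nbhs; split => //; exact: cdom_open.
  by apply: filterS2 N1 N2 => q /= + cq; rewrite !cmapK.
have [[p0 _]|/forallNP M0] := pselect (exists p : M, True); last first.
  by exists 0 => p; have := M0 p.
exists (f p0) => p.
have oA : open [set q | f q = f p0].
  by rewrite openE => q /= fq; apply: filterS (loc q) => r /= ->.
have cA : closed [set q | f q = f p0].
  rewrite -openC openE => q /= fq; apply: filterS (loc q) => r.
  by rewrite /setC/= => ->.
have AT : [set q | f q = f p0] = setT.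
  apply: (@manifold_connected _ _ M); first by exists p0.
  - by exists [set q | f q = f p0] => //; rewrite setTI.
  - by exists [set q | f q = f p0] => //; rewrite setTI.
by have : setT p by []; rewrite -AT.
Qed.

(** Tensorial identities, known for smooth fields only, can thereby be evaluated
    on arbitrary tangent vectors. *)
Lemma exists_extension p v : exists U X,
  [/\ open U, U p, smooth_vfield U X & X p = v].
Proof.
exists (cdom (chart_at p)), (coordinate_field (chart_at p) v).
split; [exact: cdom_open|exact: chart_at_dom| |exact: coordinate_field_at].
exact/coordinate_field_smooth/chart_at_atlas.
Qed.

End SmoothFields.

Arguments smooth_vfieldIl {R m M U V X}.
Arguments smooth_vfieldIr {R m M U V X}.

(** * Local orthonormal frames *)

Section Frames.
Context (R : realType) (m : nat) (M : manifold R m) (g : bilfield M).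
Hypothesis hg : riemannian_metric g.
Implicit Types (p : M) (u v w : 'rV[R]_m).

Lemma ev2Dl p u v w : ev2 g p (u + v) w = ev2 g p u w + ev2 g p v w.
Proof. by rewrite /ev2 !mulmxDl !mxE. Qed.

Lemma ev2Zl p (a : R) u w : ev2 g p (a *: u) w = a * ev2 g p u w.
Proof. by rewrite /ev2 -!scalemxAl !mxE. Qed.

Lemma ev2Dr p u v w : ev2 g p w (u + v) = ev2 g p w u + ev2 g p w v.
Proof. by rewrite !(Defs.metric_sym hg p w) ev2Dl. Qed.

Lemma ev2Zr p (a : R) u w : ev2 g p w (a *: u) = a * ev2 g p w u.
Proof. by rewrite !(Defs.metric_sym hg p w) ev2Zl. Qed.

Lemma ev2Nl p u w : ev2 g p (- u) w = - ev2 g p u w.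
Proof. by rewrite -scaleN1r ev2Zl mulN1r. Qed.

Lemma ev2Nr p u w : ev2 g p w (- u) = - ev2 g p w u.
Proof. by rewrite -scaleN1r ev2Zr mulN1r. Qed.

Lemma ev20l p w : ev2 g p 0 w = 0.
Proof. by rewrite -(scale0r 0) ev2Zl mul0r. Qed.

Lemma ev2_suml p (I : Type) (r : seq I) (F : I -> 'rV[R]_m) w :
  ev2 g p (\sum_(i <- r) F i) w = \sum_(i <- r) ev2 g p (F i) w.
Proof.
by elim/big_rec2: _ => [|i a b _ <-]; rewrite ?ev20l ?ev2Dl.
Qed.

Lemma ev2_inj p u v : (forall w, ev2 g p u w = ev2 g p v w) -> u = v.
Proof.
move=> H; apply/eqP; rewrite -subr_eq0; apply/negPn/negP => /(Defs.metric_pos hg p).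
by rewrite ev2Dl ev2Nl H subrr ltxx.
Qed.

Lemma exists_row_notin_span k (A : 'M[R]_(k, m)) : (k < m)%N ->
  exists v : 'rV[R]_m, ~~ (v <= A)%MS.
Proof.
move=> km; have : ~~ ((1%:M : 'M[R]_m) <= A)%MS.
  apply/negP => /mxrankS; rewrite mxrank1 => /leq_trans/(_ (rank_leq_row A)).
  by rewrite leqNgt km.
by move=> /row_subPn[i ?]; exists (row i 1%:M).
Qed.

(** Gram-Schmidt, one vector at a time.  The new vector is chosen outside of the
    span of the others at the single point p; the neighbourhood then shrinks to
    the open set where the remainder of the orthogonal projection is nonzero. *)
Lemma exists_orthonormal_family p k : (k <= m)%N ->
  exists U (E : 'I_k -> vfield M), [/\ open U, U p,
    forall i, smooth_vfield U (E i) &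
    forall q, U q -> forall i j, ev2 g q (E i q) (E j q) = (i == j)%:R].
Proof.
elim: k => [_|k IH km].
  by exists setT, (fun=> fun=> 0); split; [exact: openT| | case | move=> q _ []].
have [U0 [E [oU0 U0p sE oE]]] := IH (ltnW km).
have [v vE] := exists_row_notin_span (\matrix_i E i p) km.
have [U1 [X [oU1 U1p sX Xp]]] := exists_extension p v.
pose V := U0 `&` U1.
have oV : open V by exact: openI.
have {}sX : smooth_vfield V X by apply: smooth_vfield_subset sX => q [].
have {}sE i : smooth_vfield V (E i) by apply: smooth_vfield_subset (sE i) => q [].
(* w is X minus its orthogonal projection to the span of the E i *)
pose a i (q : M) : R^o := ev2 g q (X q) (E i q).
have sa i : smooth_on V (a i) := metric_smooth hg oV sX (sE i).
pose w : vfield M := fun q => X q + \sum_i (- a i q : R^o) *: E i q.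
have sw : smooth_vfield V w.
  exact: (smooth_vfieldD oV sX (smooth_vfield_sum _ oV
    (fun i => smooth_vfieldZ oV (smooth_onN oV (sa i)) (sE i)))).
have wE q j : V q -> ev2 g q (w q) (E j q) = 0.
  move=> [U0q _]; rewrite /w ev2Dl ev2_suml (bigD1 j)//= big1 => [|i /negPf ij].
    by rewrite ev2Zl oE// eqxx mulr1 addr0 subrr.
  by rewrite ev2Zl oE// ij mulr0.
pose f (q : M) : R^o := ev2 g q (w q) (w q).
have sf : smooth_on V f := metric_smooth hg oV sw sw.
have fp : 0 < f p.
  apply: (Defs.metric_pos hg); apply: contraNneq vE => w0.
  have -> : v = \sum_i a i p *: row i (\matrix_i E i p).
    move/eqP: w0; rewrite /w Xp addr_eq0 => /eqP ->; rewrite -sumrN.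
    by apply: eq_bigr => i _; rewrite rowK scaleNr opprK.
  by apply: summx_sub => i _; apply: scalemx_sub; exact: row_sub.
pose U := [set q | V q /\ 0 < f q].
have oU : open U.
  rewrite openE => q [Vq fq]; rewrite /interior.
  have N1 : \forall r \near q, V r by exact: open_nbhs_nbhs.
  have N2 : \forall r \near q, 0 < f r.
    have cf := smooth_on_continuous oV sf Vq.
    exact: (cf _ (lt_nbhsr fq)).
  by apply: filterS2 N1 N2.
have UV : U `<=` V by move=> q [].
pose e : vfield M := fun q => (f q `^ (- 2^-1) : R^o) *: w q.
have se : smooth_vfield U e.
  have f0 q : U q -> 0 < f q by case.
  exact: (smooth_vfieldZ oU (smooth_on_powR _ oU f0 (smooth_on_subset UV sf))
    (smooth_vfield_subset UV sw)).
have ee q : U q -> ev2 g q (e q) (e q) = 1.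
  move=> [_ fq]; rewrite ev2Zl ev2Zr -/(f q) powRN powR12_sqrt ?ltW//.
  rewrite mulrA -invfM -expr2 sqr_sqrtr ?ltW// mulVf// gt_eqF//.
have eE q j : U q -> ev2 g q (e q) (E j q) = 0.
  by move=> [Vq _]; rewrite ev2Zl wE// mulr0.
exists U, (fun i => if unlift ord_max i is Some j then E j else e).
split; [exact: oU|by split| |].
- move=> i; case: unliftP => [j _|_]; last exact: se.
  exact: smooth_vfield_subset UV (sE j).
- move=> q Uq i j; case: unliftP => [i' ->|->]; case: unliftP => [j' ->|->].
  + by rewrite oE ?(inj_eq lift_inj)//; case: Uq => -[].
  + by rewrite Defs.metric_sym// eE// eq_sym (negPf (neq_lift _ _)).
  + by rewrite eE// (negPf (neq_lift _ _)).
  + by rewrite ee// eqxx.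
Qed.

Lemma exists_orthonormal_frame p :
  exists U (E : 'I_m -> vfield M), [/\ open U, U p & orthonormal_frame g U E].
Proof.
by have [U [E [? ? ? ?]]] := exists_orthonormal_family p (leqnn m); exists U, E.
Qed.

(** If A has the e i as rows and G is the Gram matrix of the metric, then
    orthonormality says A G A^T = 1; a one-sided inverse of a square matrix is
    two-sided, so that (G A^T) A = 1, which is the claim. *)
Lemma orthonormal_parseval p (e : 'I_m -> 'rV[R]_m) u v :
  (forall i j, ev2 g p (e i) (e j) = (i == j)%:R) ->
  \sum_i ev2 g p (e i) u * ev2 g p (e i) v = ev2 g p u v.
Proof.
move=> oe; pose A : 'M[R]_m := \matrix_i e i.
have AG : A *m (g p *m A^T) = 1%:M.
  apply/matrixP => i j; rewrite mulmxA !mxE -oe /ev2 !mxE.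
  apply: eq_bigr => l _; rewrite !mxE; congr (_ * _).
  by apply: eq_bigr => l' _; rewrite !mxE.
have GA := mulmx1C AG.
have gs : (g p)^T = g p.
  apply/matrixP => i j; have := Defs.metric_sym hg p (delta_mx 0 i) (delta_mx 0 j).
  have E i' j' : ev2 g p (delta_mx 0 i') (delta_mx 0 j') = g p i' j'.
    by rewrite /ev2 -rowE trmx_delta -colE !mxE.
  by rewrite !E mxE.
have S x i : ev2 g p (e i) x = (x *m (g p *m A^T)) 0 i.
  rewrite Defs.metric_sym// /ev2 mulmxA !mxE; apply: eq_bigr => l _.
  by rewrite !mxE.
under eq_bigr do rewrite !S.
transitivity ((u *m (g p *m A^T) *m (v *m (g p *m A^T))^T) 0 0).
  rewrite [RHS]mxE; apply: eq_bigr => i _; congr (_ * _).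
  by rewrite [RHS]mxE.
rewrite !trmx_mul trmxK gs /ev2 !mulmxA; congr (fun_of_matrix (_ *m _) 0 0).
by rewrite -(mulmxA u) -(mulmxA u) GA mulmx1.
Qed.
End Frames.

(** * The Levi-Civita connection and the characteristic vector field *)

Section LeviCivita.
Context (R : realType) (m : nat) (M : manifold R m) (g : bilfield M)
  (nabla : vfield M -> vfield M -> vfield M).
Hypothesis hn : levi_civita g nabla.
Implicit Types (U : set M) (X Y : vfield M).

(** The indicator function of U is smooth on U with zero derivative there, and
    its products with Y and Y' are the same global field: the Leibniz rule
    identifies nabla_X of that product with nabla_X Y and with nabla_X Y'. *)
Lemma nabla_local U X Y Y' p : open U -> smooth_vfield U X ->
  smooth_vfield U Y -> (forall q, U q -> Y q = Y' q) -> U p ->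
  nabla X Y p = nabla X Y' p.
Proof.
move=> oU sX sY YY Up.
pose f (q : M) : R := (q \in U)%:R.
have f1 q : U q -> f q = 1 by move=> Uq; rewrite /f mem_set.
have sf : smooth_on U (f : M -> R^o).
  apply: (smooth_on_congr oU _ (@smooth_on_cst _ _ _ _ U (1 : R^o))).
  by move=> q /f1.
have df : along X (f : M -> R^o) p = 0.
  rewrite /along -[RHS](tderive_cst (1 : R^o) p (X p)).
  apply: tderive_near; apply: filterS (_ : nbhs p U); first exact: f1.
  exact: open_nbhs_nbhs.
have sY' := smooth_vfield_congr oU YY sY.
have := nabla_leibniz hn oU sX sY sf Up.
rewrite df scale0r addr0 f1// scale1r => <-.
have := nabla_leibniz hn oU sX sY' sf Up.
rewrite df scale0r addr0 f1// scale1r => <-.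
congr (nabla X _ p); apply/funext => q; rewrite /f.
case: (boolP (q \in U)) => [|_]; last by rewrite !scale0r.
by rewrite inE => /YY ->.
Qed.

Lemma nabla_zero U X p : open U -> smooth_vfield U X -> U p ->
  nabla X (fun=> 0) p = 0.
Proof.
move=> oU sX Up; have s0 := smooth_vfield0 oU.
have := nabla_leibniz hn oU sX s0 (@smooth_on_cst _ _ _ _ U (0 : R^o)) Up.
under eq_fun do rewrite scaler0.
by rewrite scale0r scaler0 addr0.
Qed.
End LeviCivita.

Section Contact.
Context (R : realType) (m : nat) (M : manifold R m) (phi : endofield M)
  (xi : vfield M) (eta : oneform M) (g : bilfield M) (alpha beta : M -> R)
  (nabla : vfield M -> vfield M -> vfield M).
Hypothesis hn : levi_civita g nabla.
Hypothesis hc : alpha_beta_contact nabla phi xi eta g alpha beta.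
Implicit Types (U : set M) (X Y : vfield M) (p : M) (u v : 'rV[R]_m).

Let ac := abc_acm hc.
Let hg := acm_metric ac.

Lemma xi_smooth U : smooth_vfield U xi.
Proof. by apply: smooth_vfield_subset (acm_xi_smooth ac). Qed.

Lemma eta_metric p v : ev1 eta p v = ev2 g p v (xi p).
Proof. by rewrite -(acm_dual ac) Defs.metric_sym. Qed.

Lemma metric_xi_xi p : ev2 g p (xi p) (xi p) = 1.
Proof. by rewrite (acm_dual ac) (acm_eta_xi ac). Qed.

Lemma metric_phi_self p v : ev2 g p (v *m phi p) v = 0.
Proof.
have := acm_skew ac p v v; rewrite (Defs.metric_sym hg p v) => /eqP.
by rewrite -addr_eq0 -mulr2n mulrn_eq0 => /eqP.
Qed.

(** The derivative of the constant function g(xi, xi) = 1. *)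
Lemma eta_nabla_xi U X p : open U -> smooth_vfield U X -> U p ->
  ev1 eta p (nabla X xi p) = 0.
Proof.
move=> oU sX Up; rewrite eta_metric.
have := nabla_metric hn oU sX (@xi_smooth U) (@xi_smooth U) Up.
have -> : (met g xi xi : M -> R^o) = fun=> 1.
  by apply/funext => q; exact: metric_xi_xi.
rewrite /along tderive_cst /met (Defs.metric_sym hg p (xi p)) => /esym/eqP.
by rewrite -mulr2n mulrn_eq0 => /eqP.
Qed.

(** As phi xi = 0, the derivative of phi in the direction X, applied to xi, is
    - phi (nabla_X xi); applying phi once more recovers nabla_X xi, which is
    orthogonal to xi. *)
Lemma nabla_xi U X p : open U -> smooth_vfield U X -> U p ->
  nabla X xi p = alpha p *: (X p - ev1 eta p (X p) *: xi p)
                 - beta p *: (X p *m phi p).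
Proof.
move=> oU sX Up.
have := abc_nabla_phi hc oU sX (@xi_smooth U) Up.
have phixi : endo_app phi xi = fun=> 0.
  by apply/funext => q; exact: (acm_phi_xi ac).
rewrite /nabla_endo phixi (nabla_zero hn oU sX Up) sub0r /met {1}/endo_app.
rewrite /endo_app (acm_skew ac) (acm_phi_xi ac).
rewrite (Defs.metric_sym hg p _ 0) ev20l oppr0 scale0r sub0r.
rewrite (acm_eta_xi ac) !scale1r -eta_metric => /(congr1 (mulmx^~ (phi p))).
rewrite mulmxDl mulNmx (acm_phi_sq ac) (eta_nabla_xi oU sX Up) scale0r subr0.
rewrite opprK => ->.
rewrite -!scalemxAl mulNmx mulmxBl -!scalemxAl (acm_phi_xi ac) scaler0 sub0r.
by rewrite (acm_phi_sq ac) opprK scalerN.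
Qed.

(** The alpha-part of nabla xi is symmetric, the beta-part is skew: only the
    former contributes to the Lie derivative of g. *)
Lemma lie_metric_xi U X Y p : open U -> smooth_vfield U X ->
  smooth_vfield U Y -> U p ->
  lie_metric g xi X Y p =
  2 * alpha p * (ev2 g p (X p) (Y p) - ev1 eta p (X p) * ev1 eta p (Y p)).
Proof.
move=> oU sX sY Up; have sxi := @xi_smooth U.
rewrite /lie_metric (nabla_metric hn oU sxi sX sY Up) /met.
rewrite -(nabla_torsion_free hn oU sxi sX Up).
rewrite -(nabla_torsion_free hn oU sxi sY Up).
rewrite (nabla_xi oU sX Up) (nabla_xi oU sY Up).
set NX := nabla xi X p; set NY := nabla xi Y p.
rewrite !(ev2Dl, ev2Zl, ev2Nl, ev2Dr hg, ev2Zr hg, ev2Nr hg) (acm_skew ac).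
rewrite (acm_dual ac) -eta_metric; ring.
Qed.

Lemma exists_horizontal p : (1 < m)%N -> exists v, ev1 eta p v = 0 /\ v != 0.
Proof.
move=> m1; have [u uxi] := exists_row_notin_span (xi p) m1.
exists (u - ev1 eta p u *: xi p); split.
  by rewrite eta_metric ev2Dl ev2Nl ev2Zl metric_xi_xi -eta_metric mulr1 subrr.
apply: contraNneq uxi => /eqP; rewrite subr_eq0 => /eqP ->.
exact: scalemx_sub.
Qed.

End Contact.

(** * The Ricci operator of a soliton and its derivative *)

Section Soliton.
Context (R : realType) (m : nat) (M : manifold R m) (phi : endofield M)
  (xi : vfield M) (eta : oneform M) (g : bilfield M) (alpha beta : M -> R)
  (nabla : vfield M -> vfield M -> vfield M).
Hypothesis hn : levi_civita g nabla.
Hypothesis hc : alpha_beta_contact nabla phi xi eta g alpha beta.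
Implicit Types (U : set M) (X Y : vfield M) (p : M) (u v : 'rV[R]_m).
Variables (Ric : tensor02 M) (Q : endofield M).
Hypothesis hRic : is_ricci_tensor g nabla Ric.
Hypothesis hQ : is_ricci_operator g Ric Q.

Let ac := abc_acm hc.
Let hg := acm_metric ac.

(** Passage from an identity between fields to an identity between the tensors
    at p, by extending tangent vectors. *)
Lemma ricci_operatorE p (a b : R) :
  (forall U X Y, open U -> smooth_vfield U X -> smooth_vfield U Y -> U p ->
    Ric X Y p = a * ev2 g p (X p) (Y p)
                + b * (ev1 eta p (X p) * ev1 eta p (Y p))) ->
  forall v, v *m Q p = a *: v + (b * ev1 eta p v) *: xi p.
Proof.
move=> H v; apply: (ev2_inj hg (p := p)) => w.
have [U [X [oU Up sX Xp]]] := exists_extension p v.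
have [V [Y [oV Vp sY Yp]]] := exists_extension p w.
have oUV : open (U `&` V) by exact: openI.
have := hQ.2 _ _ _ oUV (smooth_vfieldIl sX) (smooth_vfieldIr sY) p (conj Up Vp).
rewrite (H _ _ _ oUV (smooth_vfieldIl sX) (smooth_vfieldIr sY) (conj Up Vp)).
rewrite /met /endo_app Xp Yp => ->.
by rewrite ev2Dl !ev2Zl (acm_dual ac) mulrA.
Qed.

(** Contraction of the soliton equation over an orthonormal frame.  The traces
    of g and of eta (x) eta are m and 1, and the mixed terms are summed by
    Parseval's identity. *)
Lemma riemann_soliton_ricci lambda U X Y p :
  almost_riemann_soliton g nabla xi lambda ->
  open U -> smooth_vfield U X -> smooth_vfield U Y -> U p ->
  Ric X Y p =
    ((m%:R - 1) * lambda p - (2 * m%:R - 3) * alpha p) * ev2 g p (X p) (Y p)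
    + (m%:R - 2) * alpha p * (ev1 eta p (X p) * ev1 eta p (Y p)).
Proof.
move=> hs oU sX sY Up.
have [V [E [oV Vp [sE oE]]]] := exists_orthonormal_frame hg p.
have oUV : open (U `&` V) by exact: openI.
have sX' := smooth_vfieldIl (V := V) sX; have sY' := smooth_vfieldIl (V := V) sY.
have sE' i := smooth_vfieldIr (U := U) (sE i).
have UVp : (U `&` V) p by [].
have fE : orthonormal_frame g (U `&` V) E by split=> // q [_]; exact: oE.
rewrite (hRic oUV fE sX' sY' UVp).
pose a i := ev2 g p (E i p) (X p); pose b i := ev2 g p (E i p) (Y p).
pose e i := ev2 g p (E i p) (xi p).
(* The part of the curvature that does not depend on i, kept opaque so that
   distributing the sum over i leaves it in one piece. *)
have [K KE] : exists K, K = (lambda p - 2 * alpha p) * ev2 g p (X p) (Y p)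
  + alpha p * (ev1 eta p (X p) * ev1 eta p (Y p)) by eexists.
have T i : curvature4 g nabla (E i) X Y (E i) p =
    K + alpha p * ev2 g p (X p) (Y p) * (e i * e i)
    - (lambda p - 2 * alpha p) * (a i * b i)
    - alpha p * ev1 eta p (Y p) * (e i * a i)
    - alpha p * ev1 eta p (X p) * (e i * b i).
  have := hs _ _ _ _ _ oUV (sE' i) sX' sY' (sE' i) p UVp.
  rewrite /kulkarni_nomizu.
  have L X' Y' sX'' sY'' := @lie_metric_xi _ _ _ _ _ _ _ _ _ _ hn hc _ X' Y' p
    oUV sX'' sY'' UVp.
  rewrite (L _ _ (sE' i) (sE' i)) (L _ _ sX' sY') (L _ _ (sE' i) sY').
  rewrite (L _ _ sX' (sE' i)).
  have EE : ev2 g p (E i p) (E i p) = 1 by have := oE p Vp i i; rewrite eqxx.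
  rewrite /met EE -!(Defs.metric_sym hg p (E i p)) -/(a i) -/(b i).
  rewrite [ev1 eta p (E i p)](eta_metric hc) -/(e i) => H.
  have {H} -> := canRL (addKr _) H.
  by rewrite KE; field.
under eq_bigr do rewrite T.
rewrite !(sumrB, big_split) /= -!mulr_sumr.
have P u v := orthonormal_parseval hg u v (oE p Vp).
rewrite /e /a /b !P sumr_const card_ord (metric_xi_xi hc) !(acm_dual ac).
rewrite -[K *+ m]mulr_natl KE; ring.
Qed.

Lemma ricci_soliton_ricci lambda U X Y p :
  almost_ricci_soliton g Ric xi lambda ->
  open U -> smooth_vfield U X -> smooth_vfield U Y -> U p ->
  Ric X Y p = (lambda p - alpha p) * ev2 g p (X p) (Y p)
              + 1 * alpha p * (ev1 eta p (X p) * ev1 eta p (Y p)).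
Proof.
move=> hs oU sX sY Up; have := hs U X Y oU sX sY p Up.
rewrite (lie_metric_xi hn hc oU sX sY Up) /met => /(canRL (addKr _)) ->.
by field.
Qed.

Section PhiParallel.
Variables (a : M -> R) (c : R).
Hypothesis c0 : c != 0.
Hypothesis m1 : (1 < m)%N.
Hypothesis QE : forall p v,
  v *m Q p = a p *: v + (c * alpha p * ev1 eta p v) *: xi p.
Hypothesis hpar : phi_parallel_endo nabla phi Q.

Lemma Q_xi p : xi p *m Q p = (a p + c * alpha p) *: xi p.
Proof. by rewrite QE (acm_eta_xi ac) mulr1 scalerDl. Qed.

(** This is the function g(Q xi, xi). *)
Lemma ricci_eigenvalue_smooth : smooth_function (fun p => a p + c * alpha p).
Proof.
apply: (smooth_on_congr openT _ (metric_smooth hg openT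
  (hQ.1 _ _ openT (acm_xi_smooth ac)) (acm_xi_smooth ac))).
by move=> p _; rewrite /endo_app Q_xi ev2Zl (metric_xi_xi hc) mulr1.
Qed.

(** Evaluate phi^2 (nabla_X Q) xi = 0 for X = v orthogonal to xi at p, and take
    the scalar product with v: the derivative of the eigenvalue only produces a
    multiple of xi, which phi kills, and the beta-part of nabla_X xi is
    orthogonal to v, whence c alpha^2 |v|^2 = 0. *)
Lemma alpha_eq0 p : alpha p = 0.
Proof.
have [v [etav v0]] := exists_horizontal hc p m1.
have [U [X [oU Up sX Xp]]] := exists_extension p v.
have sxi := @xi_smooth _ _ _ _ _ _ _ _ _ _ hc U.
have := hpar oU sX sxi Up.
have sf : smooth_on U (fun q => a q + c * alpha q : R^o).
  by apply: smooth_on_subset ricci_eigenvalue_smooth.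
rewrite /nabla_endo.
have -> : endo_app Q xi = fun q => (a q + c * alpha q) *: xi q.
  by apply/funext => q; exact: Q_xi.
rewrite /endo_app (nabla_leibniz hn oU sX sxi sf Up) QE.
rewrite (eta_nabla_xi hn hc oU sX Up) mulr0 scale0r addr0.
set N := nabla X xi p; set d := along _ _ p.
have -> : (a p + c * alpha p) *: N + d *: xi p - a p *: N
    = (c * alpha p) *: N + d *: xi p.
  by rewrite scalerDl addrAC [a p *: N + _]addrC addrK.
rewrite mulmxDl -!scalemxAl (acm_phi_xi ac) scaler0 addr0 -scalemxAl.
rewrite (acm_phi_sq ac) (eta_nabla_xi hn hc oU sX Up) scale0r subr0 scalerN.
move/eqP; rewrite oppr_eq0 => /eqP /(congr1 (fun w => ev2 g p w v)).
rewrite ev2Zl ev20l /N (nabla_xi hn hc oU sX Up) Xp etav scale0r subr0.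
rewrite -scaleNr ev2Dl !ev2Zl (metric_phi_self hc) mulr0 addr0 => /eqP.
rewrite !mulf_eq0 (negPf c0) (gt_eqF (Defs.metric_pos hg p v0)) orbF /=.
by rewrite orbb => /eqP.
Qed.

Lemma Q_scalar p v : v *m Q p = a p *: v.
Proof. by rewrite QE alpha_eq0 mulr0 mul0r scale0r addr0. Qed.

(** Once Q = a Id, the Leibniz rule gives (nabla_X Q) Y = X(a) Y, and phi^2 is
    injective on vectors orthogonal to xi. *)
Lemma eigenvalue_constant : is_constant a.
Proof.
have sa : smooth_function a.
  apply: (smooth_on_congr openT _ ricci_eigenvalue_smooth) => p _.
  by rewrite alpha_eq0 mulr0 addr0.
apply: is_constant_derive0 => // U X p oU sX Up.
have [v [etav v0]] := exists_horizontal hc p m1.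
have [V [Y [oV Vp sY Yp]]] := exists_extension p v.
have oUV : open (U `&` V) by exact: openI.
have UVp : (U `&` V) p by [].
have sX' := smooth_vfieldIl (V := V) sX; have sY' := smooth_vfieldIr (U := U) sY.
have sa' : smooth_on (U `&` V) (a : M -> R^o) by exact: smooth_on_subset sa.
have := hpar oUV sX' sY' UVp.
rewrite /nabla_endo.
have -> : endo_app Q Y = fun q => a q *: Y q.
  by apply/funext => q; exact: Q_scalar.
rewrite /endo_app (nabla_leibniz hn oUV sX' sY' sa' UVp) Q_scalar.
rewrite addrAC subrr add0r Yp -!scalemxAl (acm_phi_sq ac) etav scale0r subr0.
move/eqP; rewrite scaler_eq0 oppr_eq0 (negPf v0) orbF.
by move/eqP.
Qed.

(** With nabla_X xi = - beta phi X, the terms in nabla_xi X cancel out of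
    R(X, xi) xi, which becomes xi(beta) phi X - beta^2 phi^2 X; the first term
    is orthogonal to X. *)
Lemma curvature_xi_xi U X p : open U -> smooth_vfield U X -> U p ->
  curvature4 g nabla X xi xi X p =
  beta p ^+ 2 * (ev2 g p (X p) (X p) - ev1 eta p (X p) * ev1 eta p (X p)).
Proof.
move=> oU sX Up; have sxi V := @xi_smooth _ _ _ _ _ _ _ _ _ _ hc V.
have nxi V Y q : open V -> smooth_vfield V Y -> V q ->
    nabla Y xi q = - beta q *: (Y q *m phi q).
  move=> oV sY Vq; rewrite (nabla_xi hn hc oV sY Vq) alpha_eq0 scale0r sub0r.
  by rewrite scaleNr.
have nxixi : nabla xi xi = fun=> 0.
  apply/funext => q; rewrite (nxi setT xi q openT (sxi setT) I).
  by rewrite (acm_phi_xi ac) scaler0.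
have sphiX := acm_phi_smooth ac oU sX.
have sb : smooth_on U (fun q => - beta q : R^o).
  by apply: smooth_onN => //; exact: smooth_on_subset (abc_beta_smooth hc).
have tf q : U q -> lie_bracket X xi q = nabla X xi q + (-1 : R^o) *: nabla xi X q.
  by move=> Uq; rewrite scaleN1r (nabla_torsion_free hn oU sX (sxi U) Uq).
have sL : smooth_vfield U (lie_bracket X xi).
  apply: (smooth_vfield_congr oU (fun q Uq => esym (tf q Uq))).
  exact: (smooth_vfieldD oU (nabla_smooth hn oU sX (sxi U))
    (smooth_vfieldZ oU (@smooth_on_cst _ _ _ _ U (- 1 : R^o))
      (nabla_smooth hn oU (sxi U) sX))).
rewrite /curvature4 /curvature /met nxixi (nabla_zero hn oU sX Up) sub0r.
rewrite (nxi U _ _ oU sL Up) tf// (nxi U X p oU sX Up).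
(* The formula for nabla_X xi holds on U only. *)
rewrite (nabla_local hn (Y' := fun q => - beta q *: endo_app phi X q) oU
  (sxi U) (nabla_smooth hn oU sX (sxi U)) (fun q Uq => nxi U X q oU sX Uq) Up).
rewrite (nabla_leibniz hn oU (sxi U) sphiX sb Up).
have := abc_nabla_phi hc oU (sxi U) sX Up.
rewrite alpha_eq0 scale0r add0r /met (acm_dual ac) subrr scaler0.
rewrite /nabla_endo => /eqP; rewrite subr_eq0 => /eqP ->.
set N := nabla xi X p; set d := along _ _ p; rewrite /endo_app.
rewrite mulmxDl -!scalemxAl.
rewrite !(ev2Dl, ev2Zl, ev2Nl) (metric_phi_self hc) (acm_skew ac _ (X p *m phi p)).
rewrite (acm_compat ac); ring.
Qed.

(** Ric(xi, xi) computed in two ways: from Q = a Id, and as the trace of the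
    curvature. *)
Lemma ricci_xi_xi p : a p = (m%:R - 1) * beta p ^+ 2.
Proof.
have [U [E [oU Up fE]]] := exists_orthonormal_frame hg p.
have sxi := @xi_smooth _ _ _ _ _ _ _ _ _ _ hc U.
have := hQ.2 _ _ _ oU sxi sxi p Up.
rewrite /met /endo_app Q_scalar ev2Zl (metric_xi_xi hc) mulr1 => ->.
rewrite (hRic oU fE sxi sxi Up).
have [sE oE] := fE.
under eq_bigr do rewrite (curvature_xi_xi oU (sE _) Up) !(eta_metric hc).
rewrite -mulr_sumr sumrB mulrC; congr (_ * _).
rewrite (orthonormal_parseval hg (xi p) (xi p) (oE p Up)) (metric_xi_xi hc).
congr (_ - _).
under eq_bigr => i _ do rewrite (oE p Up i i : ev2 g p _ _ = _) eqxx.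
by rewrite sumr_const card_ord.
Qed.

Lemma scalar_curvatureE p : scalar_curvature Q p = m%:R * a p.
Proof.
rewrite /scalar_curvature; have -> : Q p = (a p)%:M.
  by apply/row_matrixP => i; rewrite !rowE Q_scalar mul_mx_scalar.
by rewrite mxtrace_scalar mulr_natl.
Qed.

(** beta^2 is constant, because it is a constant multiple of a. *)
Lemma phi_parallel_dichotomy : cosymplectic alpha beta \/
  ((forall p, alpha p = 0) /\ (forall p, beta p <> 0)).
Proof.
have [k ak] := eigenvalue_constant.
have [k0|k0] := eqVneq k 0; [left|right]; split; try exact: alpha_eq0.
- have := ricci_xi_xi p; rewrite ak k0 => /esym/eqP.
  rewrite mulf_eq0 subr_eq0 (_ : (m%:R == 1 :> R) = false) /=; last first.
    by rewrite pnatr_eq1 gtn_eqF.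
  by rewrite sqrf_eq0 => /eqP.
- move=> p b0; have := ricci_xi_xi p.
  by rewrite ak b0 expr0n mulr0; exact/eqP.
Qed.

End PhiParallel.
End Soliton.

(** * The two soliton equations together *)

Section Conclusion.
Context (R : realType) (m : nat) (M : manifold R m) (phi : endofield M)
  (xi : vfield M) (eta : oneform M) (g : bilfield M) (alpha beta : M -> R)
  (nabla : vfield M -> vfield M -> vfield M).
Hypothesis hn : levi_civita g nabla.
Hypothesis hc : alpha_beta_contact nabla phi xi eta g alpha beta.
Variables (Ric : tensor02 M) (Q : endofield M).
Hypothesis hRic : is_ricci_tensor g nabla Ric.
Hypothesis hQ : is_ricci_operator g Ric Q.
Variables (a : M -> R) (c d : R) (lambda : M -> R).
Hypothesis c0 : c != 0.
Hypothesis m1 : (1 < m)%N.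
Hypothesis QE : forall p v,
  v *m Q p = a p *: v + (c * alpha p * ev1 eta p v) *: xi p.
Hypothesis d0 : d != 0.
Hypothesis aE : forall p, alpha p = 0 -> a p = d * lambda p.

Lemma parallel_phi_parallel : parallel_endo nabla Q ->
  phi_parallel_endo nabla phi Q.
Proof.
move=> hpar U X Y oU sX sY p Up.
by rewrite /endo_app (hpar U X Y oU sX sY p Up) !mul0mx.
Qed.

Lemma phi_parallel_scalar_curvature : phi_parallel_endo nabla phi Q ->
  [/\ forall p, alpha p = 0, is_constant lambda,
      is_constant (scalar_curvature Q) &
      forall p, scalar_curvature Q p = m%:R * d * lambda p].
Proof.
move=> hpar.
have al0 := alpha_eq0 hn hc hQ c0 m1 QE hpar.
have [k ak] := eigenvalue_constant hn hc hQ c0 m1 QE hpar.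
have sE := scalar_curvatureE hn hc hQ c0 m1 QE hpar.
split=> //.
- by exists (d^-1 * k) => p; rewrite -(ak p) aE// mulKf.
- by exists (m%:R * k) => p; rewrite sE ak.
- by move=> p; rewrite sE aE// mulrA.
Qed.

(** The two soliton equations differ only in the constants: c is the coefficient
    of alpha in the eta (x) xi part of Q, and d is the ratio of the eigenvalue a
    to lambda once alpha vanishes. *)
Lemma soliton_alternatives :
  (parallel_endo nabla Q ->
    (forall p, alpha p = 0) /\ is_constant (scalar_curvature Q) /\
    (forall p, scalar_curvature Q p = m%:R * d * lambda p)) /\
  (phi_parallel_endo nabla phi Q ->
    cosymplectic alpha beta \/
    ((forall p, alpha p = 0) /\ (forall p, beta p <> 0) /\
     is_constant lambda /\ is_constant (scalar_curvature Q) /\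
     (forall p, scalar_curvature Q p = m%:R * d * lambda p))).
Proof.
split=> [/parallel_phi_parallel hpar|hpar];
  have [al0 cl cs sE] := phi_parallel_scalar_curvature hpar; first by split.
have [|[_ b0]] := phi_parallel_dichotomy hn hc hRic hQ c0 m1 QE hpar.
  by left.
by right; do !split.
Qed.
End Conclusion.

Theorem proposition3p7 (R : realType) (n : nat) (hn : (1 <= n)%N)
    (M : manifold R (2 * n + 1)%N)
    (phi : endofield M) (xi : vfield M) (eta : oneform M) (g : bilfield M)
    (alpha beta : M -> R)
    (nabla : vfield M -> vfield M -> vfield M)
    (h_nabla : levi_civita g nabla)
    (h_contact : alpha_beta_contact nabla phi xi eta g alpha beta)
    (Ric : tensor02 M) (h_Ric : is_ricci_tensor g nabla Ric)
    (Q : endofield M) (h_Q : is_ricci_operator g Ric Q)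
    (lambda : M -> R) (h_lambda : smooth_function lambda) :
  (almost_riemann_soliton g nabla xi lambda ->
    (parallel_endo nabla Q ->
      (forall p, alpha p = 0) /\
      is_constant (scalar_curvature Q) /\
      (forall p, scalar_curvature Q p = (2 * n * (2 * n + 1))%:R * lambda p)) /\
    (phi_parallel_endo nabla phi Q ->
      cosymplectic alpha beta \/
      ((forall p, alpha p = 0) /\ (forall p, beta p <> 0) /\
       is_constant lambda /\
       is_constant (scalar_curvature Q) /\
       (forall p, scalar_curvature Q p = (2 * n * (2 * n + 1))%:R * lambda p))))
  /\
  (almost_ricci_soliton g Ric xi lambda ->
    (parallel_endo nabla Q ->
      (forall p, alpha p = 0) /\
      is_constant (scalar_curvature Q) /\
      (forall p, scalar_curvature Q p = (2 * n + 1)%:R * lambda p)) /\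
    (phi_parallel_endo nabla phi Q ->
      cosymplectic alpha beta \/
      ((forall p, alpha p = 0) /\ (forall p, beta p <> 0) /\
       is_constant lambda /\
       is_constant (scalar_curvature Q) /\
       (forall p, scalar_curvature Q p = (2 * n + 1)%:R * lambda p)))).
Proof.
(* The dimension is at least 3; so 2n - 1, the coefficient of alpha in the
   Riemann case, cannot vanish, and neither can 2n. *)
have m1 : (1 < 2 * n + 1)%N by rewrite addn1 ltnS muln_gt0.
have n0 : (2 * n)%:R != 0 :> R by rewrite pnatr_eq0 muln_eq0 /= -lt0n.
split=> hs.
- have -> : (2 * n * (2 * n + 1))%:R = (2 * n + 1)%:R * (2 * n)%:R :> R.
    by rewrite mulnC natrM.
  have c0 : (2 * n + 1)%:R - 2 != 0 :> R.
    rewrite subr_eq0 eqr_nat addn1 eqSS; apply/eqP => /(congr1 odd).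
    by rewrite oddM.
  apply: (soliton_alternatives h_nabla h_contact h_Ric h_Q c0 m1 _ n0).
  + move=> p v; apply: (ricci_operatorE h_contact h_Q) => U X Y oU sX sY Up.
    exact: (riemann_soliton_ricci h_nabla h_contact h_Ric hs oU sX sY Up).
  + by move=> p /= ->; rewrite natrD; ring.
- rewrite -[(2 * n + 1)%:R]mulr1.
  apply: (soliton_alternatives h_nabla h_contact h_Ric h_Q (oner_neq0 R) m1 _
    (oner_neq0 R)).
  + move=> p v; apply: (ricci_operatorE h_contact h_Q) => U X Y oU sX sY Up.
    exact: (ricci_soliton_ricci h_nabla h_contact hs oU sX sY Up).
  + by move=> p /= ->; rewrite subr0 mul1r.
Qed.
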